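(* Let $E$ be a directed graph, $R\subseteq E^0_{\mathrm{reg}}$, $N:E^1\to(1,\infty)$ a function, and $\beta\in[0,\infty)$. The map $W_{\mathrm{inf}}$ from $D^\beta$ to the set of $[0,1]$-valued functions on $E^0_{\beta\text{-crit}}/_{\sim}$ given by $$W_{\mathrm{inf}}(m)(\mathfrak{v})=m(v)Z_v^a(\beta)$$ for $\mathfrak{v}\in E^0_{\beta\text{-crit}}/_{\sim}$, $v\in\mathfrak{v}$, is well-defined, and is a convex isomorphism from $D^\beta_{\mathrm{con}}$ onto $$\Bigl\{\epsilon:(E^0_{\beta\text{-crit}}/_{\sim})\to[0,1]\Bigm|\sum_{\mathfrak{v}\in E^0_{\beta\text{-crit}}/_{\sim}}\epsilon(\mathfrak{v})=1\Bigr\}.$$ Moreover, setting $m^\beta_{\mathfrak{v}}:=m^\beta_v$ for $v\in\mathfrak{v}\in E^0_{\beta\text{-crit}}/_{\sim}$ is well-defined (independent of the choice of $v\in\mathfrak{v}$), and the inverse of $W_{\mathrm{inf}}$ (restricted to $D^\beta_{\mathrm{con}}$) is $\epsilon\mapsto\sum_{\mathfrak{v}\in E^0_{\beta\text{-crit}}/_{\sim}}\epsilon(\mathfrak{v})\,m^\beta_{\mathfrak{v}}$.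
   Context: **Graphs.** A directed graph $E=(E^0,E^1,s,r)$ consists of arbitrary (not necessarily countable) sets $E^0$ (vertices), $E^1$ (edges) and maps $s,r:E^1\to E^0$. A path of length $n\ge1$ is a sequence $e_1\cdots e_n$ of edges with $r(e_i)=s(e_{i+1})$; vertices are paths of length $0$. $E^*$ is the set of all finite paths; $s(u)=s(e_1)$, $r(u)=r(e_n)$ for $u=e_1\cdots e_n$, and $s(v)=r(v)=v$ for $v\in E^0$. $vE^1=\{e\in E^1:s(e)=v\}$; $E^0_{\mathrm{reg}}=\{v: vE^1\text{ finite and non-empty}\}$. For paths, $u'\le u$ means $u'$ is an initial segment of $u$ (the initial segment of length $0$ is $s(u)$), and $u'<u$ means $u'\le u$, $u'\ne u$. Sums of nonnegative terms over arbitrary index sets are suprema of finite partial sums, in $[0,\infty]$. **Path space.** $E^\infty$ is the set of infinite paths, $E^{\le\infty}=E^*\cup E^\infty$; $Z(u)=\{x\in E^{\le\infty}:u\le x\}$ for $u\in E^*$. $E^{\le\infty}$ has the topology generated by all $Z(u)$ and their complements, and $\partial_RE=E^\infty\cup\{u\in E^*:r(u)\notin R\}$ has the subspace topology. $E^\infty_{\mathrm{rec}}$ is the set of recurrent paths: $x\in E^\infty$ such that for some $v\in E^0$ the set $\{u\in E^*:u<x,\ r(u)=v\}$ is infinite. **Weights.** $N$ is extended to $E^*$ by $N(v)=1$ for $v\in E^0$ and $N(e_1\cdots e_n)=N(e_1)\cdots N(e_n)$. **$D^\beta$ and associated measures.** $D^\beta$ is the set of functions $m:E^0\to[0,1]$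 with $\sum_{v\in E^0}m(v)=1$; $m(v)=\sum_{e\in vE^1}N(e)^{-\beta}m(r(e))$ for $v\in R$; and $m(v)\ge\sum_{e\in vE^1}N(e)^{-\beta}m(r(e))$ for all $v\in E^0$. Each $m\in D^\beta$ has an associated measure: the unique regular Borel probability measure $\mu$ on $\partial_RE$ with $\mu(Z(v)\cap\partial_RE)=m(v)$ for all $v\in E^0$ and $\mu(eA)=N(e)^{-\beta}\mu(A)$ for all $e\in E^1$ and Borel $A\subseteq Z(r(e))\cap\partial_RE$, where $eA=\{ex:x\in A\}$. $D^\beta_{\mathrm{con}}$ (conservative functions) is the set of $m\in D^\beta$ whose associated measure $\mu$ is supported on $E^\infty_{\mathrm{rec}}$, i.e. $\mu(E^\infty_{\mathrm{rec}})=1$. **Partition functions.** For $v,v'\in E^0$: $vE_s^*v=\{u\in E^*: s(u)=r(u)=v,\ u\ne v,\ r(u')\ne v\text{ for any }v<u'<u\}$; $E_a^*v=\{u\in E^*: r(u)=v,\ r(u')\ne v\text{ for any }u'<u\}$; $v'E_a^*v=\{u\in E_a^*v: s(u)=v'\}$; $Z_v^s(\beta)=\sum_{u\in vE_s^*v}N(u)^{-\beta}$; $Z_v^a(\beta)=\sum_{u\in E_a^*v}N(u)^{-\beta}$. $E^0_{\beta\text{-crit}}=\{v: Z_v^a(\beta)<\infty,\ Z_v^s(\beta)=1\}$. For $v$ with $Z_v^a(\beta)<\infty$ and $Z^s_v(\beta)\le1$, $m_v^\beta(v')=\sum_{u\in v'E_a^*v}N(u)^{-\beta}(Z_v^a(\beta))^{-1}$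 for $v'\in E^0$. **Equivalence.** $v_1\sim v_2$ means there are finite paths from $v_1$ to $v_2$ and from $v_2$ to $v_1$; $E^0_{\beta\text{-crit}}/_{\sim}$ is the set of equivalence classes in $E^0_{\beta\text{-crit}}$. A convex isomorphism is a bijection preserving convex combinations. *)

(* Defs.v *)
From HB Require Import structures.
From mathcomp Require Import all_boot all_order all_algebra.
From mathcomp Require Import all_classical all_reals all_analysis.

Set Implicit Arguments.
Unset Strict Implicit.
Unset Printing Implicit Defensive.

Import Order.TTheory GRing.Theory Num.Theory.
Import numFieldNormedType.Exports.

Local Open Scope classical_set_scope.
Local Open Scope ring_scope.

(* Classically every type carries a [choiceType] structure
   ([boolp.gen_choiceMixin]), so vertices and edges are arbitrary sets. *)
Record digraph := Digraph {
  vert : choiceType;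
  edge : choiceType;
  src : edge -> vert;
  tgt : edge -> vert }.

Section Paths.
Variable E : digraph.

Fixpoint walk (v : vert E) (p : seq (edge E)) : bool :=
  if p is e :: p' then (src e == v) && walk (tgt e) p' else true.

(* [(v, [:: e_1; ...; e_n])] is the path e_1...e_n with source v; the source
   is stored because for n = 0 the path is the vertex v itself. *)
Definition finpath := {p : vert E * seq (edge E) | walk p.1 p.2}.
HB.instance Definition _ := Choice.on finpath.

Definition psrc (u : finpath) : vert E := (val u).1.
Definition pedges (u : finpath) : seq (edge E) := (val u).2.
Definition ptgt (u : finpath) : vert E :=
  last (psrc u) (map (@tgt E) (pedges u)).

Definition vpath (v : vert E) : finpath := exist _ (v, [::]) isT.

Definition infpath := {x : nat -> edge E | forall n, tgt (x n) = src (x n.+1)}.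

Variant pspace := Fin of finpath | Inf of infpath.

HB.instance Definition _ := gen_eqMixin pspace.
HB.instance Definition _ := gen_choiceMixin pspace.

(* [initseg u x] is u <= x; for finite paths u' and u, the relation u' <= u is
   [initseg u' (Fin u)]. *)
Definition initseg (u : finpath) (x : pspace) : Prop :=
  match x with
  | Fin w => psrc u = psrc w /\ prefix (pedges u) (pedges w)
  | Inf y => psrc u = src (sval y 0%N) /\
             pedges u = mkseq (sval y) (size (pedges u))
  end.

Definition pinitseg (u : finpath) (x : pspace) : Prop :=
  initseg u x /\ Fin u <> x.

Definition cylinder (u : finpath) : set pspace := [set x | initseg u x].

Definition cylinders_and_complements : set (set pspace) :=
  [set A | exists u, A = cylinder u \/ A = ~` cylinder u].

HB.instance Definition _ :=
  @isSubBaseTopological.Build pspace (set pspace) cylinders_and_complements id.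

Definition infinite_paths : set pspace := [set x | exists y, x = Inf y].

Definition recurrent_paths : set pspace :=
  [set x | infinite_paths x /\
    exists v, infinite_set [set u : finpath | pinitseg u x /\ ptgt u = v]].

(* [econs e x y] states that r(e) = s(x) and y = ex. *)
Definition econs (e : edge E) (x y : pspace) : Prop :=
  match x, y with
  | Fin u, Fin w =>
      [/\ psrc u = tgt e, psrc w = src e & pedges w = e :: pedges u]
  | Inf x', Inf y' =>
      [/\ src (sval x' 0%N) = tgt e, sval y' 0%N = e
        & forall n, sval y' n.+1 = sval x' n]
  | _, _ => False
  end.

Definition out_edges (v : vert E) : set (edge E) := [set e | src e = v].

Definition regular_vertices : set (vert E) :=
  [set v | finite_set (out_edges v) /\ out_edges v !=set0].

Definition boundary (Rg : set (vert E)) : set pspace :=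
  infinite_paths `|` [set x | exists2 u, x = Fin u & ~ Rg (ptgt u)].

(* The sets v E_s^* v, E_a^* v and v' E_a^* v of the partition functions. *)
Definition simple_loops (v : vert E) : set finpath :=
  [set u | [/\ psrc u = v, ptgt u = v, u <> vpath v &
    forall u', pinitseg (vpath v) (Fin u') -> pinitseg u' (Fin u) ->
      ptgt u' <> v]].

Definition first_arrivals (v : vert E) : set finpath :=
  [set u | ptgt u = v /\ forall u', pinitseg u' (Fin u) -> ptgt u' <> v].

Definition first_arrivals_from (v' v : vert E) : set finpath :=
  [set u | first_arrivals v u /\ psrc u = v'].

Definition connected_to (v w : vert E) : Prop :=
  exists u : finpath, psrc u = v /\ ptgt u = w.

Definition vequiv (v w : vert E) : Prop :=
  connected_to v w /\ connected_to w v.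

Lemma vequiv_refl (v : vert E) : vequiv v v.
Proof. by split; exists (vpath v). Qed.

End Paths.

(* The library's measurable types are pointed.  [borel x0] is the space X with
   its Borel sigma-algebra; the point x0 only serves to provide that structure
   and so costs nothing, a space without points having no probability. *)
Definition borel_carrier (X : topologicalType) (x0 : X) : Type := X.
HB.instance Definition _ (X : topologicalType) (x0 : X) :=
  Choice.copy (borel_carrier x0) X.
HB.instance Definition _ (X : topologicalType) (x0 : X) :=
  isPointed.Build (borel_carrier x0) x0.

Definition borel_open (X : topologicalType) (x0 : X) :
  set (set (borel_carrier x0)) := @open X.
Arguments borel_open : clear implicits.

Notation borel x0 := (g_sigma_algebraType (borel_open _ x0)).

(* For finite measures on a locally compact Hausdorff space the common variants
   of regularity agree with this one, which asks for outer regularity by open sets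
   and inner regularity by compact sets on all Borel sets. *)
Definition regular_measure (R : realType) (X : topologicalType) (x0 : X)
    (mu : probability (borel x0) R) : Prop :=
  forall A : set X, measurable (A : set (borel x0)) ->
    mu A = ereal_inf [set mu U | U in [set U : set X | open U /\ A `<=` U]] /\
    mu A = ereal_sup [set mu K | K in [set K : set X | compact K /\ K `<=` A]].

Section Weights.
Variables (R : realType) (E : digraph) (Rg : set (vert E)).
Variables (N : edge E -> R) (beta : R).

Definition pweight (u : finpath E) : R := \prod_(e <- pedges u) N e.

Definition Dbeta : set (vert E -> R) :=
  [set m | [/\ forall v, 0 <= m v <= 1,
     (\esum_(v in [set: vert E]) (m v)%:E = 1)%E,
     forall v, Rg v ->
       ((m v)%:E = \esum_(e in out_edges v)
          (N e `^ (- beta) * m (tgt e))%:E)%E &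
     forall v,
       (\esum_(e in out_edges v) (N e `^ (- beta) * m (tgt e))%:E
          <= (m v)%:E)%E]].

Definition associated_measure (m : vert E -> R) (x0 : boundary Rg)
    (mu : probability (borel x0) R) : Prop :=
  [/\ regular_measure mu,
    forall v, mu (set_val @^-1` cylinder (vpath v)) = (m v)%:E &
    forall (e : edge E) (A : set (boundary Rg)),
      measurable (A : set (borel x0)) ->
      A `<=` set_val @^-1` cylinder (vpath (tgt e)) ->
      mu [set y | exists2 x, A x & econs e (set_val x) (set_val y)]
        = ((N e `^ (- beta))%:E * mu A)%E].

(* The associated measure of a given m is unique, so "its associated measure
   satisfies P" is written "some associated measure satisfies P". *)
Definition Dbeta_con : set (vert E -> R) :=
  [set m | Dbeta m /\
     exists (x0 : boundary Rg) (mu : probability (borel x0) R),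
       associated_measure m mu /\
       mu (set_val @^-1` @recurrent_paths E) = 1%E].

Definition Zs (v : vert E) : \bar R :=
  (\esum_(u in simple_loops v) (pweight u `^ (- beta))%:E)%E.

Definition Za (v : vert E) : \bar R :=
  (\esum_(u in first_arrivals v) (pweight u `^ (- beta))%:E)%E.

Definition crit_vertices : set (vert E) :=
  [set v | (Za v < +oo)%E /\ Zs v = 1%E].

(* m_v^beta; meaningful when [Za v] is finite. *)
Definition mvert (v : vert E) : vert E -> R := fun v' =>
  fine (\esum_(u in first_arrivals_from v' v) (pweight u `^ (- beta))%:E)%E
    * (fine (Za v))^-1.

Definition crit_classes : set (set (vert E)) :=
  [set [set w | crit_vertices w /\ vequiv v w] | v in crit_vertices].

Lemma crit_class_inhabited (c : crit_classes) : exists v, set_val c v.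
Proof.
case: c => c hc; have [v cv ec] := set_mem hc.
exists v; rewrite /set_val /= -ec; split => //; exact: vequiv_refl.
Qed.

Definition class_repr (c : crit_classes) : vert E :=
  sval (cid (crit_class_inhabited c)).

(* These two are defined through a chosen representative of each class; their
   independence of this choice is part of the theorem. *)
Definition Winf (m : vert E -> R) : crit_classes -> R := fun c =>
  m (class_repr c) * fine (Za (class_repr c)).

Definition mclass (c : crit_classes) : vert E -> R := mvert (class_repr c).

Definition class_simplex : set (crit_classes -> R) :=
  [set eps | (forall c, 0 <= eps c <= 1) /\
     (\esum_(c in [set: crit_classes]) (eps c)%:E = 1)%E].

Definition class_mixture (eps : crit_classes -> R) (v : vert E) : \bar R :=
  (\esum_(c in [set: crit_classes]) (eps c * mclass c v)%:E)%E.

End Weights.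

Definition convex_isomorphism (R : realType) (V W : lmodType R)
    (A : set V) (B : set W) (f : V -> W) : Prop :=
  [/\ convex_set A, convex_set B, set_bij A B f &
    forall (t : R) (x y : V), 0 <= t <= 1 -> A x -> A y ->
      f (t *: x + (1 - t) *: y) = t *: f x + (1 - t) *: f y].

(* Main.v *)
(* For a vertex v with Z_v^s = 1, the function w |-> sum over w E_a^* v of N^-beta
   is harmonic, and the minimum principle forces every superharmonic m to be a
   multiple of it on the vertices reachable from v.  Hence equivalent critical
   vertices give proportional functions, inequivalent ones do not see each other,
   and the sum over c of W(m)(c) m_c is the mass carried by the paths that visit a
   critical vertex.
   If the associated measure is carried by the recurrent paths, this mass is 1: a
   vertex with Z^s < 1 is almost surely visited finitely often (Borel-Cantelli),
   so a recurrent path almost surely visits a critical vertex.  Hence m is the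
   mixture of the m_c with weights W(m).
   Conversely a mixture of the m_c is harmonic and carried by countably many
   edges.  Its measure is the image of Lebesgue measure on [0, 1[ under the map
   sending t to the path selected by nested intervals of lengths N(u)^-beta m(r(u)).
   Almost every path visits a critical vertex, and returns to it because
   Z^s = 1 there, so it is recurrent. *)
Require Import Defs.
From HB Require Import structures.
From mathcomp Require Import all_boot all_order all_algebra finmap.
From mathcomp Require Import all_classical all_reals all_analysis.
From mathcomp Require Import ring lra.

Set Implicit Arguments.
Unset Strict Implicit.
Unset Printing Implicit Defensive.

Import Order.TTheory GRing.Theory Num.Theory.
Import numFieldNormedType.Exports.

Local Open Scope classical_set_scope.
Local Open Scope ring_scope.

(** * Sums over arbitrary sets *)

Section ExtendedSums.
Context {R : realType}.
Local Open Scope ereal_scope.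

(** The graph may be uncountable, so the boundary need not be second countable and unions of
    cylinders may be uncountable. Upper bounds for the measure of such a union come from regularity
    and compactness, lower bounds from disjointness; together they translate between measures and
    sums. The sums are walk sums, over walks that stay in a set [D] until they end in a set [B].
    Each is the least solution of a one-step recursion, so identities are proved by comparison, with
    infinite values allowed. Both sides meet in one number: the sum over starting vertices of the
    walk sum to the critical set weighted by [m]. Pointwise this walk sum is at most [m], so the
    number is at most 1. A measure carried by recurrent paths forces the value 1, which turns the
    pointwise bound into an equality; conversely the value 1 makes a measure on the infinite paths
    recurrent. *)

Lemma pmule_lI (k : R) (x y : \bar R) : (0 < k)%R ->
  k%:E * x = k%:E * y -> x = y.
Proof.
move=> k0 xy; apply/eqP; rewrite eq_le; apply/andP.
by split; rewrite -(@lee_pmul2l _ k%:E)// xy.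
Qed.

Lemma esum_le_sub (T : choiceType) (A B : set T) (a : T -> \bar R) :
  A `<=` B -> \esum_(i in A) a i <= \esum_(i in B) a i.
Proof.
move=> AB; apply: ge_ereal_sup => _ [X [finX XA] <-].
by apply: ereal_sup_ubound; exists X => //; split => // x /XA/AB.
Qed.

Lemma esum_ge1 (T : choiceType) (A : set T) (a : T -> \bar R) t :
  (forall i, 0 <= a i) -> A t -> a t <= \esum_(i in A) a i.
Proof.
move=> a0 At; rewrite -(@esum_set1 R T t a) ?a0//.
by apply: esum_le_sub => _ ->.
Qed.

Lemma esumZl (T : choiceType) (A : set T) (c : R) (a : T -> \bar R) :
  (0 <= c)%R -> (forall i, 0 <= a i) ->
  \esum_(i in A) (c%:E * a i) = c%:E * \esum_(i in A) a i.
Proof.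
move=> c0 a0; rewrite /esum -ereal_supZl//; last first.
  by apply/set0P; exists 0; exists set0; rewrite ?fsbig_set0//; exact: fsets_set0.
congr ereal_sup; apply/seteqP; split => [_ [X XA <-]|_ [_ [X XA <-] <-]].
  by exists (\sum_(x \in X) a x)%R; [exists X|rewrite ge0_mule_fsumr].
by exists X => //; rewrite ge0_mule_fsumr.
Qed.

Lemma esum_exchange (T1 T2 : choiceType) (A : set T1) (B : set T2)
    (a : T1 -> T2 -> \bar R) : (forall i j, 0 <= a i j) ->
  \esum_(i in A) \esum_(j in B) a i j = \esum_(j in B) \esum_(i in A) a i j.
Proof.
move=> a0; rewrite !esum_esum//.
apply: (reindex_esum _ _ (fun x : T2 * T1 => (x.2, x.1))).
split=> [[i j] []//|[i1 j1] [i2 j2] _ _ [-> ->]//|[i j] [Ai Bj]].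
by exists (j, i).
Qed.

(** A strict inequality at one index would survive in the totals, because the rest of the smaller
    sum is finite and cancels. *)
Lemma esum_eq_le (T : choiceType) (A : set T) (a b : T -> \bar R) :
  (forall i, 0 <= a i) -> (forall i, A i -> a i <= b i) ->
  \esum_(i in A) a i < +oo -> \esum_(i in A) b i <= \esum_(i in A) a i ->
  forall i, A i -> a i = b i.
Proof.
move=> a0 ab afin ba i Ai; apply/eqP; rewrite eq_le ab//=.
have Ei : A `&` [set i] = [set i] by apply/setIidPr => _ ->.
move: ba; rewrite (esumID [set i] A a)// (esumID [set i] A b); last first.
  by move=> j Aj; apply: le_trans (ab _ Aj).
rewrite Ei !esum_set1//; last by apply: le_trans (ab _ Ai).
move: (afin); rewrite (esumID [set i] A a)// Ei esum_set1//.
set r := \esum_(j in _) a j; set s := \esum_(j in _) b j.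
have rs : r <= s by apply: le_esum => j [Aj _]; exact: ab.
move=> fin h.
have r0 : 0 <= r by exact: esum_ge0.
have rf : r \is a fin_num.
  rewrite ge0_fin_numE//; apply: le_lt_trans fin.
  by rewrite leeDr.
by rewrite -(@leeD2rE _ r)//; apply: le_trans h; rewrite leeD2l.
Qed.

Lemma countable_esum (T : choiceType) (A : set T) (a : T -> \bar R) :
  (forall i, 0 <= a i) -> \esum_(i in A) a i < +oo ->
  countable [set i | A i /\ 0 < a i].
Proof.
move=> a0 fin.
have -> : [set i | A i /\ 0 < a i] =
    \bigcup_n [set i | A i /\ (n.+1%:R^-1)%:E <= a i].
  apply/seteqP; split => [i [Ai ai]|i [n _ [Ai]]]; last first.
    by move=> h; split => //; apply: lt_le_trans h; rewrite lte_fin.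
  have [n hn] : exists n, (n.+1%:R^-1)%:E <= a i.
    case: (a i) ai => [r|_|//]; last by exists 0%N; rewrite leey.
    rewrite lte_fin => r0; have [n] := ltr_add_invr r0.
    by rewrite add0r => nr; exists n; rewrite lee_fin ltW.
  by exists n.
apply: bigcup_countable => // n _; apply: finite_set_countable.
apply: contrapT => inf.
have [r rE] : exists r, \esum_(i in A) a i = r%:E.
  exists (fine (\esum_(i in A) a i)); rewrite fineK// ge0_fin_numE//.
  exact: esum_ge0.
(* [k] terms of size at least [1/(n+1)] already exceed the total [r]. *)
have [k rk] : exists k, (r * n.+1%:R < k%:R)%R.
  exists (Num.trunc (r * n.+1%:R)).+1; exact: truncnS_gt.
have [X XA kX] := infinite_set_fset k inf.
have : \sum_(i \in [set` X]) a i <= r%:E.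
  rewrite -rE; apply: ereal_sup_ubound; exists [set` X] => //; split => //.
  by move=> i /XA [].
rewrite fsbig_finite// ?set_fsetK leNgt => /negP; apply.
apply: (@lt_le_trans _ _ (\sum_(i <- X) (n.+1%:R^-1)%:E)); last first.
  rewrite big_seq [leRHS]big_seq; apply: lee_sum => i iX.
  by have [] := XA i iX.
rewrite sumEFin lte_fin big_const_seq count_predT iter_addr_0.
rewrite -[ltRHS]mulr_natl ltr_pdivlMr//.
apply: lt_le_trans rk _.
by rewrite ler_nat.
Qed.

End ExtendedSums.

(** * Potential theory of the weighted graph *)

Section Potential.
Context {R : realType} {E : digraph} (K : edge E -> R).
Hypothesis K_gt0 : forall e, (0 < K e)%R.
Local Open Scope ereal_scope.

Let K_ge0 e : (0 <= K e)%R. Proof. exact: ltW. Qed.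

Definition wt (p : seq (edge E)) : R := (\prod_(e <- p) K e)%R.

Definition pend (v : vert E) (p : seq (edge E)) : vert E :=
  last v (map (@tgt E) p).

(** With [D] the complement of [B] these are the walks stopped at their first arrival in [B]; with
    [D] equal to [setT] they are all walks ending in [B]. *)
Fixpoint walk_to (D B : set (vert E)) (v : vert E) (p : seq (edge E)) : Prop :=
  if p is e :: p' then [/\ D v, src e = v & walk_to D B (tgt e) p'] else B v.

Definition step (f : vert E -> \bar R) (v : vert E) : \bar R :=
  \esum_(e in out_edges v) ((K e)%:E * f (tgt e)).

(** The set [L] of allowed lengths serves twice: truncation to [k < n] permits induction on the
    length, and single lengths describe visits at a fixed time. *)
Definition walk_sum (L : set nat) (D B : set (vert E)) (g : vert E -> \bar R)
    (v : vert E) : \bar R :=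
  \esum_(p in [set p | walk_to D B v p /\ L (size p)])
    ((wt p)%:E * g (pend v p)).

Definition superharmonic (f : vert E -> \bar R) :=
  (forall v, 0 <= f v) /\ forall v, step f v <= f v.

Lemma wt_gt0 p : (0 < wt p)%R.
Proof. by rewrite /wt; apply: prodr_gt0 => e _. Qed.

Lemma wt_ge0 p : (0 <= wt p)%R.
Proof. exact/ltW/wt_gt0. Qed.

Lemma wt_cons e p : (wt (e :: p) = K e * wt p)%R.
Proof. by rewrite /wt big_cons. Qed.

Lemma wt_cat p q : (wt (p ++ q) = wt p * wt q)%R.
Proof. by rewrite /wt big_cat. Qed.

Lemma le_step f g v : (forall e, src e = v -> f (tgt e) <= g (tgt e)) ->
  step f v <= step g v.
Proof. by move=> fg; apply: le_esum => e ev; rewrite lee_wpmul2l ?lee_fin ?fg. Qed.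

Lemma step_ge0 f v : (forall w, 0 <= f w) -> 0 <= step f v.
Proof. by move=> f0; apply: esum_ge0 => e _; rewrite mule_ge0 ?lee_fin. Qed.

Lemma stepZ (c : R) f v : (0 <= c)%R -> (forall w, 0 <= f w) ->
  step (fun w => c%:E * f w) v = c%:E * step f v.
Proof.
move=> c0 f0; rewrite /step -esumZl// => [|e]; last by rewrite mule_ge0 ?lee_fin.
by apply: eq_esum => e _; rewrite muleCA.
Qed.

Lemma esum_cons (O : set (edge E)) (W : edge E -> set (seq (edge E)))
    (a : seq (edge E) -> \bar R) : (forall p, 0 <= a p) ->
  \esum_(p in [set p | if p is e :: p' then O e /\ W e p' else False]) a p =
  \esum_(e in O) \esum_(p in W e) a (e :: p).
Proof.
move=> a0; rewrite esum_esum//.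
apply: (reindex_esum _ _ (fun ep : edge E * seq (edge E) => ep.1 :: ep.2)).
split => [[e p] []//|[e p] [f q] _ _ /= [-> ->]//|[//|e p] [Oe Wp]].
by exists (e, p).
Qed.

Lemma walk_sum_ge0 L D B g v : (forall w, 0 <= g w) -> 0 <= walk_sum L D B g v.
Proof. by move=> g0; apply: esum_ge0 => p _; rewrite mule_ge0 ?lee_fin ?wt_ge0. Qed.

(** The empty walk gives the first summand; a nonempty walk loses its first edge, hence the shifted
    [L]. *)
Lemma walk_sumE L D B g v : (forall w, 0 <= g w) ->
  walk_sum L D B g v =
  (if `[< B v /\ L 0%N >] then g v else 0) +
  (if `[< D v >] then step (walk_sum [set n | L n.+1] D B g) v else 0).
Proof.
move=> g0; rewrite {1}/walk_sum (esumID [set [::]]); last first.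
  by move=> p _; rewrite mule_ge0 ?lee_fin ?wt_ge0.
congr (_ + _).
  case: asboolP => [[Bv L0]|nB].
    rewrite (_ : _ `&` _ = [set [::]]).
      by rewrite esum_set1 /wt /pend ?big_nil/= ?mul1e//; exact: g0.
    by apply/seteqP; split => [p []//|_ ->].
  rewrite (_ : _ `&` _ = set0) ?esum_set0//.
  by apply/seteqP; split => // p [] /[swap] -> /=.
case: asboolP => Dv; last first.
  rewrite (_ : _ `&` _ = set0) ?esum_set0//.
  by apply/seteqP; split => // -[|e p] /= [] // [[]].
set Z := _ `&` _.
have -> : Z = [set p | if p is e :: p' then out_edges v e /\
    [set p | walk_to D B (tgt e) p /\ L (size p).+1] p' else False].
  rewrite /Z; apply/seteqP; split => -[|e p] //=; first by case=> _; apply.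
  - by case=> -[[_ ev w] Lp] _.
  - by case=> ev [w Lp]; split.
rewrite esum_cons => [|p]; last by rewrite mule_ge0 ?lee_fin ?wt_ge0.
rewrite /step; apply: eq_esum => e _; rewrite -esumZl//; last first.
  by move=> p; rewrite mule_ge0 ?lee_fin ?wt_ge0.
by apply: eq_esum => p _; rewrite wt_cons EFinM -muleA.
Qed.

(* The walk sum is the least solution of its recursion; the first alternative
   allows the recursion to be replaced by the bound itself at some vertices. *)
Lemma walk_sum_min D B g f : (forall w, 0 <= g w) -> (forall w, 0 <= f w) ->
  (forall v, walk_sum setT D B g v <= f v \/
    (if `[< B v >] then g v else 0) + (if `[< D v >] then step f v else 0) <= f v) ->
  forall v, walk_sum setT D B g v <= f v.
Proof.
move=> g0 f0 h.
have fin n v : walk_sum [set k | (k < n)%N] D B g v <= f v.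
  elim: n v => [|n IH] v.
    rewrite /walk_sum (_ : mkset _ = set0) ?esum_set0//.
    by apply/seteqP; split => // p [].
  have [le|le] := h v.
    by apply: le_trans le; apply: esum_le_sub => p [].
  rewrite walk_sumE//; apply: le_trans le; apply: leeD.
    by rewrite (_ : (B v /\ _) = B v)//; apply/propext; split => [[]//|].
  case: asboolP => // Dv; apply: le_step => e _; exact: IH.
move=> v; apply: ge_ereal_sup => _ [X [finX XA] <-].
pose n := (\max_(p <- fset_set X) size p).+1.
apply: le_trans (fin n v); apply: ereal_sup_ubound; exists X => //; split => //.
move=> p Xp; split; first by have [] := XA _ Xp.
rewrite /= /n ltnS; apply: leq_bigmax_seq => //.
by rewrite in_fset_set// inE.
Qed.

Lemma walk_to_end D B v p : walk_to D B v p -> B (pend v p).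
Proof. by elim: p v => [|e p IH] v //= [_ _ /IH]. Qed.

Lemma walk_to_walk D B v p : walk_to D B v p -> walk v p.
Proof. by elim: p v => [|e p IH] v //= [_ -> /IH ->]; rewrite eqxx. Qed.

Lemma walk_toT B v p : walk v p -> B (pend v p) -> walk_to setT B v p.
Proof. by elim: p v => [|e p IH] v //= /andP[/eqP ev wp] Bp; split => //; exact: IH. Qed.

Lemma walk_to_first (B : set (vert E)) v p : walk v p -> B (pend v p) ->
  exists n, walk_to (~` B) B v (take n p).
Proof.
elim: p v => [|e p IH] v /=; first by exists 0%N.
move=> /andP[/eqP ev wp] Bp; have [Bv|nBv] := pselect (B v); first by exists 0%N.
by have [n hn] := IH _ wp Bp; exists n.+1.
Qed.

(** A first arrival stops as soon as it meets [B], so a proper extension would leave a vertex of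
    [B]. This is what makes cylinders of first arrivals disjoint. *)
Lemma walk_to_antichain (B : set (vert E)) v p q :
  walk_to (~` B) B v p -> walk_to (~` B) B v (p ++ q) -> q = [::].
Proof.
elim: p v => [|e p IH] v /=; last by move=> [_ _ /IH h] [_ _ /h].
by case: q => [//|e q] Bv [].
Qed.

Lemma esum_walk_sum L D B g :
  (forall w, 0 <= g w) ->
  \esum_(q in [set q | walk_to D B q.1 q.2 /\ L (size q.2)])
    ((wt q.2)%:E * g (pend q.1 q.2)) =
  \esum_(v in [set: vert E]) walk_sum L D B g v.
Proof.
move=> g0; rewrite esum_esum => [|v p _ _]; last by rewrite mule_ge0 ?lee_fin ?wt_ge0.
by congr esum; apply/seteqP; split => -[v p] //= [].
Qed.

Lemma walk_sum_size D B g v : (forall w, 0 <= g w) ->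
  \esum_(j in [set: nat]) walk_sum [set j] D B g v = walk_sum setT D B g v.
Proof.
move=> g0; rewrite esum_esum => [|j p _ _]; last by rewrite mule_ge0 ?lee_fin ?wt_ge0.
rewrite [RHS](reindex_esum (setT `*`` (fun j : nat =>
  [set p | walk_to D B v p /\ [set j] (size p)])) _ snd)//.
split => [[j p] [_ []]//|[i p] [j q]|p [wp _]]; last by exists (size p, p).
by rewrite !inE /= => -[_ [_ <-]] [_ [_ <-]] ->.
Qed.

Lemma walk_toP D B v p : walk_to D B v p <-> [/\ walk v p, B (pend v p) &
  forall n, (n < size p)%N -> D (pend v (take n p))].
Proof.
elim: p v => [|e p IH] v /=; first by split => [|[]].
split => [[Dv ev /IH [wp Bp Dp]]|[/andP[/eqP ev wp] Bp Dp]].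
  by split => //; [rewrite ev eqxx|case=> [//|n] /Dp].
split; [exact: (Dp 0%N)|by []|apply/IH; split => // n].
exact: (Dp n.+1).
Qed.

Lemma eq_walk_sum L D B g g' v : (forall w, B w -> g w = g' w) ->
  walk_sum L D B g v = walk_sum L D B g' v.
Proof. by move=> gg; apply: eq_esum => p [/walk_to_end/gg ->]. Qed.

Lemma walk_sumZ (c : R) L D B g v : (0 <= c)%R -> (forall w, 0 <= g w) ->
  walk_sum L D B (fun w => c%:E * g w) v = c%:E * walk_sum L D B g v.
Proof.
move=> c0 g0; rewrite -esumZl// => [|p]; last by rewrite mule_ge0 ?lee_fin ?wt_ge0.
by apply: eq_esum => p _; rewrite muleCA.
Qed.

Lemma walk_sum_esum (I : choiceType) (A : set I) L D B (g : I -> vert E -> \bar R)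
    v : (forall i w, 0 <= g i w) ->
  walk_sum L D B (fun w => \esum_(i in A) g i w) v =
  \esum_(i in A) walk_sum L D B (g i) v.
Proof.
move=> g0; rewrite -esum_exchange => [|p i]; last by rewrite mule_ge0 ?lee_fin ?wt_ge0.
by apply: eq_esum => p _; rewrite -esumZl ?wt_ge0.
Qed.

(* [hit v w], [ret v] and [tot v] are the sums over w E_a^* v, v E_s^* v and
   E_a^* v that define m_v, Z_v^s and Z_v^a. *)
Definition hit (v : vert E) : vert E -> \bar R :=
  walk_sum setT (~` [set v]) [set v] (cst 1).

Definition ret (v : vert E) : \bar R := step (hit v) v.

Definition tot (v : vert E) : \bar R := \esum_(w in [set: vert E]) hit v w.

Definition crit (v : vert E) : Prop := tot v < +oo /\ ret v = 1.

Definition reach (v w : vert E) : Prop := exists2 p, walk v p & pend v p = w.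

Lemma walk_cat v p q : walk v (p ++ q) = walk v p && walk (pend v p) q.
Proof. by elim: p v => //= e p IH v; rewrite IH andbA. Qed.

Lemma pend_cat v p q : pend v (p ++ q) = pend (pend v p) q.
Proof. by rewrite /pend map_cat last_cat. Qed.

Lemma reach_trans w v x : reach v w -> reach w x -> reach v x.
Proof.
move=> [p wp pw] [q wq qx]; exists (p ++ q); last by rewrite pend_cat pw.
by rewrite walk_cat wp pw.
Qed.

Lemma hit_ge0 v w : 0 <= hit v w.
Proof. exact: walk_sum_ge0. Qed.

Lemma hit_self v : hit v v = 1.
Proof.
rewrite /hit walk_sumE//; case: asboolP => [_|]; last by case.
by case: asboolP => [[]//|_]; rewrite adde0.
Qed.

Lemma hit_step v w : w <> v -> hit v w = step (hit v) w.
Proof.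
move=> wv; rewrite /hit walk_sumE//; case: asboolP => [[]//|_].
by case: asboolP => [_|/contrapT//]; rewrite add0e.
Qed.

(** A return starts at [v], where a first arrival would stop at once; hence the first edge is kept
    apart and only the remainder is a first arrival. *)
Definition first_returns (v : vert E) : set (seq (edge E)) :=
  [set l | if l is e :: p then out_edges v e /\
     [set p | walk_to (~` [set v]) [set v] (tgt e) p] p else False].

Lemma retE v : ret v = \esum_(l in first_returns v) (wt l)%:E.
Proof.
rewrite esum_cons => [|p]; last by rewrite lee_fin wt_ge0.
apply: eq_esum => e _; rewrite -esumZl// => [|p]; last first.
  by rewrite mule_ge0 ?lee_fin ?wt_ge0.
rewrite (_ : [set p | _ /\ _] =
    [set p | walk_to (~` [set v]) [set v] (tgt e) p]); last first.
  by apply/seteqP; split => p // [].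
by apply: eq_esum => p _; rewrite mule1 wt_cons EFinM.
Qed.

Lemma superharmonic_hit v : ret v <= 1 -> superharmonic (hit v).
Proof.
move=> r1; split => [|w]; first exact: hit_ge0.
by have [->|/eqP/hit_step<-//] := eqVneq w v; rewrite hit_self.
Qed.

Lemma harmonic_hit v w : ret v = 1 -> step (hit v) w = hit v w.
Proof.
by move=> r1; have [->|/eqP/hit_step<-//] := eqVneq w v; rewrite hit_self.
Qed.

(** [f] satisfies, with an inequality, the recursion whose least solution is [c%:E * hit v]: both
    take the value [c] at [v], and superharmonicity covers the other vertices. *)
Lemma hit_min f v w (c : R) : superharmonic f -> f v = c%:E ->
  c%:E * hit v w <= f w.
Proof.
move=> [f0 fs] fv; have c0 : (0 <= c)%R by rewrite -lee_fin -fv.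
rewrite -walk_sumZ//; apply: walk_sum_min => // [|x]; first by move=> ?; rewrite mule1.
right; rewrite mule1; case: asboolP => [->|xv].
  by case: asboolP => [[]//|_]; rewrite adde0 fv.
by rewrite add0e; case: asboolP.
Qed.

(** By [hit_min], [f v * ret v <= step f v <= f v], and [f v] cancels because it is positive and
    finite. *)
Lemma ret_le1 f v : superharmonic f -> 0 < f v -> f v < +oo -> ret v <= 1.
Proof.
move=> fs fv0 fvoo; have [c cE] : exists c, f v = c%:E.
  by exists (fine (f v)); rewrite fineK// ge0_fin_numE// ltW.
have c0 : (0 < c)%R by rewrite -lte_fin -cE.
rewrite -(@lee_pmul2l _ c%:E)// mule1 /ret -stepZ ?(ltW c0)//; last exact: hit_ge0.
rewrite -[leRHS]cE; apply: le_trans (fs.2 v); apply: le_step => e _; exact: hit_min.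
Qed.

(* Minimum principle: [f >= f v * hit v], with equality at [v]; summing over the
   edges at a vertex of equality forces equality at all of its successors. *)
Lemma hit_rigid f v w : superharmonic f -> (forall x, f x < +oo) ->
  ret v = 1 -> reach v w -> f w = f v * hit v w.
Proof.
move=> fs foo r1 [p].
have [c cE] : exists c, f v = c%:E.
  by exists (fine (f v)); rewrite fineK// ge0_fin_numE// fs.1.
have c0 : (0 <= c)%R by rewrite -lee_fin -cE fs.1.
rewrite cE; suff rigid x : f x = c%:E * hit v x -> walk x p -> pend x p = w ->
    f w = c%:E * hit v w.
  by move=> /rigid; apply; rewrite hit_self mule1.
elim: p x => [|e p IH] x fx /=; first by move=> _ <-.
move=> /andP[/eqP ev wp] pw; apply: IH wp pw.
pose a e := (K e)%:E * (c%:E * hit v (tgt e)).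
pose b e := (K e)%:E * f (tgt e).
have aS : \esum_(e in out_edges x) a e = f x.
  by rewrite fx -(harmonic_hit x r1) -stepZ//; exact: hit_ge0.
have : a e = b e.
  apply: (@esum_eq_le R _ (out_edges x)) => //.
  - by move=> i; rewrite !mule_ge0 ?lee_fin ?hit_ge0.
  - by move=> i _; rewrite lee_wpmul2l ?lee_fin// hit_min.
  - by rewrite aS.
  - by rewrite aS; exact: fs.2.
by move=> /pmule_lI ->.
Qed.

Lemma tot_ge1 v : 1 <= tot v.
Proof. by rewrite -(hit_self v); apply: esum_ge1 => // w; exact: hit_ge0. Qed.

Lemma hit_le_tot v w : hit v w <= tot v.
Proof. by apply: esum_ge1 => // x; exact: hit_ge0. Qed.

Lemma hit_lty v w : tot v < +oo -> hit v w < +oo.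
Proof. exact: le_lt_trans (hit_le_tot v w). Qed.

Lemma first_returns_walk v l : first_returns v l ->
  [/\ walk v l, pend v l = v & l <> [::]].
Proof.
case: l => [//|e p] /= [-> wp]; rewrite eqxx (walk_to_walk wp); split => //.
exact: (walk_to_end wp).
Qed.

Lemma first_returns_antichain v l k : first_returns v l ->
  first_returns v (l ++ k) -> k = [::].
Proof. by case: l => [//|e p] /= [_ wp] [_]; exact: walk_to_antichain wp. Qed.

Lemma reach_hit v w : hit w v != 0 -> reach v w.
Proof.
move=> /eqP h; apply: contrapT => nr; apply: h; apply: esum1 => p [wp _].
have := walk_to_end wp => /= pw; exfalso; apply: nr; exists p => //.
by elim: p {pw} v wp => //= e p IH v [_ -> /IH ->]; rewrite eqxx.
Qed.

Lemma crit_superharmonic v : crit v -> superharmonic (hit v).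
Proof. by move=> [_ r1]; apply: superharmonic_hit; rewrite r1. Qed.

Lemma crit_rigid f v w : superharmonic f -> (forall x, f x < +oo) ->
  crit v -> reach v w -> f w = f v * hit v w.
Proof. by move=> fs foo [_ r1]; exact: hit_rigid. Qed.

(** Rigidity of [hit w] from [v], read at [w] where [hit w] is 1. In particular a critical vertex
    that reaches another critical vertex is reached back from it. *)
Lemma crit_hit_inv v w : crit v -> crit w -> reach v w -> hit w v * hit v w = 1.
Proof.
move=> cv cw vw; rewrite -crit_rigid//; first exact: hit_self.
  exact: crit_superharmonic.
by move=> x; apply: hit_lty; case: cw.
Qed.

Lemma crit_hit_sym v w : crit v -> crit w -> hit w v != 0 ->
  reach v w /\ reach w v.
Proof.
move=> cv cw /reach_hit vw; split => //; apply: reach_hit; apply/eqP => h.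
by have := crit_hit_inv cv cw vw; rewrite h mule0 => /esym/eqP; rewrite onee_eq0.
Qed.

(** Rigidity only speaks of vertices [x] reachable from [v]. For arbitrary [x], [hit_min] is applied
    in both directions, and [crit_hit_inv] turns the second inequality into the converse of the
    first. *)
Lemma crit_hitM v w x : crit v -> crit w -> reach v w ->
  hit w x = hit v x * hit w v.
Proof.
move=> cv cw vw; apply/eqP; rewrite eq_le; apply/andP; split; last first.
  have hf : hit w v \is a fin_num.
    by rewrite ge0_fin_numE ?hit_ge0// hit_lty//; case: cw.
  by rewrite muleC -(fineK hf) hit_min ?fineK//; exact: crit_superharmonic.
have hf : hit v w \is a fin_num.
  by rewrite ge0_fin_numE ?hit_ge0// hit_lty//; case: cv.
have : hit w x * hit v w <= hit v x.
  by rewrite muleC -(fineK hf) hit_min ?fineK//; exact: crit_superharmonic.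
move=> /(lee_wpmul2r (hit_ge0 w v)).
by rewrite -muleA (muleC (hit v w)) crit_hit_inv// mule1.
Qed.

Lemma crit_totM v w : crit v -> crit w -> reach v w -> tot w = hit w v * tot v.
Proof.
move=> cv cw vw.
have hf : hit w v \is a fin_num.
  by rewrite ge0_fin_numE ?hit_ge0// hit_lty//; case: cw.
rewrite -(fineK hf) /tot -esumZl ?fine_ge0 ?hit_ge0//; last exact: hit_ge0.
by apply: eq_esum => x _; rewrite fineK// (crit_hitM _ cv cw vw) muleC.
Qed.

Lemma crit_mass f v w : superharmonic f -> (forall x, f x < +oo) ->
  crit v -> crit w -> reach v w -> f w * tot w = f v * tot v.
Proof.
move=> fs foo cv cw vw; rewrite (crit_rigid fs foo cv vw) (crit_totM cv cw vw).
by rewrite -muleA (muleA (hit v w)) (muleC (hit v w)) crit_hit_inv// mul1e.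
Qed.

Lemma mass_le f v : superharmonic f -> f v < +oo ->
  f v * tot v <= \esum_(w in [set: vert E]) f w.
Proof.
move=> fs fv; have [c cE] : exists c, f v = c%:E.
  by exists (fine (f v)); rewrite fineK// ge0_fin_numE// fs.1.
have c0 : (0 <= c)%R by rewrite -lee_fin -cE fs.1.
rewrite cE -esumZl//; last exact: hit_ge0.
by apply: le_esum => w _; exact: hit_min.
Qed.

(* Since [1 - ret v] is the defect of harmonicity of [hit v] at [v]. *)
Lemma green_le v w (d : R) : (0 <= d)%R -> d%:E + ret v <= 1 ->
  d%:E * walk_sum setT setT [set v] (cst 1) w <= hit v w.
Proof.
move=> d0 dr; rewrite -walk_sumZ//; apply: walk_sum_min => [?|x|x].
- by rewrite mule1.
- exact: hit_ge0.
- right; rewrite mule1; case: asboolP => [->|xv].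
    case: asboolP => [_|nT]; rewrite hit_self; first exact: dr.
    by case: nT.
  by rewrite add0e; case: asboolP => [_|nT]; [rewrite -hit_step|case: nT].
Qed.

(** * Decomposition over representatives of the critical classes *)

Section Classes.
Context {I : choiceType} (rep : I -> vert E).
Hypothesis crit_rep : forall i, crit (rep i).
Hypothesis rep_onto : forall v, crit v -> exists i, reach (rep i) v.
Hypothesis rep_inj : forall i j, reach (rep i) (rep j) ->
  reach (rep j) (rep i) -> i = j.

Lemma hit_rep_neq i j : i <> j -> hit (rep i) (rep j) = 0.
Proof.
move=> ij; apply/eqP; apply: contraT => /(crit_hit_sym (crit_rep j) (crit_rep i)).
by move=> [ji ij']; exfalso; apply: ij; exact: rep_inj.
Qed.

(** Only the class of [v] contributes, and its term is [f v] by rigidity. A nonzero term of another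
    index [j] would make [v] and [rep j] reach each other. *)
Lemma hit_rep_crit f v : superharmonic f -> (forall x, f x < +oo) -> crit v ->
  \esum_(i in [set: I]) f (rep i) * hit (rep i) v = f v.
Proof.
move=> fs foo cv; have [i iv] := rep_onto cv.
rewrite (esumID [set i])//; last by move=> j _; rewrite mule_ge0 ?hit_ge0// fs.1.
rewrite setTI esum_set1; last by rewrite mule_ge0 ?hit_ge0// fs.1.
rewrite -crit_rigid// esum1 ?adde0// => j [_ /= ji].
apply/eqP; rewrite mule_eq0; apply/orP; right; apply: contraT => h; exfalso.
have [vj jv] := crit_hit_sym cv (crit_rep j) h.
have hvi : hit v (rep i) != 0.
  apply/eqP => h0; have := crit_hit_inv (crit_rep i) cv iv.
  by rewrite h0 mul0e => /esym/eqP; rewrite onee_eq0.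
have [_ vi] := crit_hit_sym (crit_rep i) cv hvi.
by apply: ji; apply: rep_inj; [exact: reach_trans jv vi|exact: reach_trans iv vj].
Qed.

(** Since [rep i] is itself critical, a walk to it can be cut at its first critical vertex. Both
    inequalities follow from the minimality of walk sums. *)
Lemma hit_through_crit i v :
  walk_sum setT (~` crit) crit (hit (rep i)) v = hit (rep i) v.
Proof.
have cs := crit_superharmonic (crit_rep i).
have h0 := hit_ge0 (rep i).
apply/eqP; rewrite eq_le; apply/andP; split.
  apply: walk_sum_min => // w; right; case: asboolP => [cw|ncw].
    by case: asboolP => // _; rewrite adde0.
  by rewrite add0e; case: asboolP => // _; exact: cs.2.
apply: walk_sum_min => // [w|w]; first exact: walk_sum_ge0.
have [cw|ncw] := pselect (crit w).
  (* At a critical vertex the empty walk alone contributes [hit (rep i) w], so the bound holds there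
     without its recursion. *)
  left; rewrite (walk_sumE _ _ _ _ h0) asboolT; last by split.
  by rewrite leeDl//; case: asboolP => // _; apply: step_ge0 => x; exact: walk_sum_ge0.
right; rewrite (walk_sumE _ _ _ _ h0).
have wi : w <> rep i by move=> wi; apply: ncw; rewrite wi.
rewrite (asboolF (P := [set rep i] w))// (asboolT (P := (~` [set rep i]) w))//.
rewrite (asboolF (P := crit w /\ _)); last by case.
by rewrite (asboolT (P := (~` crit) w)).
Qed.

(** The left side reads [f] only at critical vertices, where [hit_rep_crit] expands it; after
    exchanging the sums, [hit_through_crit] applies to each term. *)
Lemma walk_sum_crit f v : superharmonic f -> (forall x, f x < +oo) ->
  walk_sum setT (~` crit) crit f v =
  \esum_(i in [set: I]) f (rep i) * hit (rep i) v.
Proof.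
move=> fs foo.
rewrite -(@eq_walk_sum _ _ _
    (fun w => \esum_(i in [set: I]) f (rep i) * hit (rep i) w)); last first.
  by move=> w cw; exact: hit_rep_crit.
rewrite walk_sum_esum => [|i w]; last by rewrite mule_ge0 ?hit_ge0// fs.1.
apply: eq_esum => i _; rewrite -[in RHS]hit_through_crit.
have [c cE] : exists c, f (rep i) = c%:E.
  by exists (fine (f (rep i))); rewrite fineK// ge0_fin_numE// fs.1.
rewrite cE walk_sumZ//; last exact: hit_ge0.
by rewrite -lee_fin -cE fs.1.
Qed.

Lemma walk_sum_crit_le f v : superharmonic f ->
  walk_sum setT (~` crit) crit f v <= f v.
Proof.
move=> fs; apply: walk_sum_min; [exact: fs.1|exact: fs.1|move=> w; right].
case: asboolP => [cw|ncw]; first by case: asboolP => // _; rewrite adde0.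
by rewrite add0e; case: asboolP => // _; exact: fs.2.
Qed.

End Classes.

End Potential.

(** * The path space and its boundary *)

Section PathSpace.
Context {E : digraph}.
Implicit Types (x : pspace E) (v : vert E) (p q : seq (edge E)) (n : nat).

Definition psource x : vert E :=
  match x with Fin w => psrc w | Inf y => src (sval y 0%N) end.

Definition pre x n : seq (edge E) :=
  match x with Fin w => take n (pedges w) | Inf y => mkseq (sval y) n end.

Definition vtx x n : vert E := pend (psource x) (pre x n).

(** Indexed by arbitrary pairs, so that no proof that [p] is a walk has to be carried along; the set
    is empty when [p] is not a walk from [v]. *)
Definition cyl v p : set (pspace E) :=
  [set x | psource x = v /\ pre x (size p) = p].

Lemma cylinderE (u : finpath E) : cylinder u = cyl (psrc u) (pedges u).
Proof.
apply/seteqP; split => -[w|y] [us up]; split => //.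
- by move: up; rewrite prefixE => /eqP.
- by rewrite prefixE; apply/eqP.
Qed.

Lemma size_pre x n : (size (pre x n) <= n)%N.
Proof.
case: x => [w|y] /=; last by rewrite size_mkseq.
by rewrite size_take; case: ltnP.
Qed.

Lemma pre_pre x m n : (m <= n)%N -> take m (pre x n) = pre x m.
Proof.
case: x => [w|y] mn /=; first by rewrite take_takel.
by rewrite /mkseq -map_take take_iota (minn_idPl mn).
Qed.

Lemma pre_walk x n : walk (psource x) (pre x n).
Proof.
case: x => [[[v p] wp]|[y hy]] /=.
  rewrite /psrc /pedges /= in wp *.
  by move: wp; rewrite -{1}(cat_take_drop n p) walk_cat => /andP[].
have H m v : v = src (y m) -> walk v (map y (iota m n)).
  elim: n m v => [//|n IH] m v -> /=; rewrite eqxx/=.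
  by apply: IH; rewrite hy.
exact: H.
Qed.

Lemma cyl_pre x n : cyl (psource x) (pre x n) x.
Proof.
split => //; case: x => [w|y] /=; last by rewrite size_mkseq.
by rewrite size_take; case: ltnP => // nw; rewrite [RHS]take_oversize// take_size.
Qed.

Lemma cyl_walk v p x : cyl v p x -> walk v p.
Proof. by move=> [<- <-]; exact: pre_walk. Qed.

Lemma cyl_comparable v p w q x : cyl v p x -> cyl w q x ->
  (size p <= size q)%N -> v = w /\ p = take (size p) q.
Proof. by move=> [<- xp] [<- xq] pq; split => //; rewrite -xq pre_pre. Qed.

Lemma cyl_take v p n x : cyl v p x -> cyl v (take n p) x.
Proof.
move=> [xv xp]; split => //; rewrite -[in RHS]xp size_take; case: ltnP => np.
  by rewrite pre_pre// ltnW.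
by rewrite take_oversize// xp.
Qed.

Lemma cyl_mk v p : walk v p -> exists u : finpath E, psrc u = v /\ pedges u = p.
Proof. by move=> vp; exists (exist _ (v, p) vp). Qed.

Lemma open_subbase (A : set (pspace E)) : cylinders_and_complements A -> open A.
Proof.
move=> cA; exists [set A]; last by rewrite bigcup_set1.
move=> _ ->; exists [fset A]%fset.
  by move=> i; rewrite finmap.inE => /eqP ->; rewrite inE.
apply/seteqP; split => x Ax; first by apply: (Ax A); rewrite /= finmap.inE.
by move=> i /=; rewrite finmap.inE => /eqP ->.
Qed.

Lemma open_cyl v p : open (cyl v p).
Proof.
have [vp|/negP nvp] := boolP (walk v p); last first.
  rewrite (_ : cyl v p = set0); first exact: open0.
  by apply/seteqP; split => // x /cyl_walk.
have [u [<- <-]] := cyl_mk vp; rewrite -cylinderE.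
by apply: open_subbase; exists u; left.
Qed.

Lemma closed_cyl v p : closed (cyl v p).
Proof.
rewrite -openC.
have [vp|/negP nvp] := boolP (walk v p); last first.
  rewrite (_ : ~` cyl v p = setT); first exact: openT.
  by apply/seteqP; split => // x _ /cyl_walk.
have [u [<- <-]] := cyl_mk vp; rewrite -cylinderE.
by apply: open_subbase; exists u; right.
Qed.

(** A subbasic set, be it a cylinder or a complement, is decided by the first [size (pedges u)]
    edges, and an infinite path has prefixes long enough for any finite intersection. At a finite
    path this can fail, since its neighbourhoods may exclude some of its extensions. *)
Lemma open_Inf_cyl (U : set (pspace E)) y : open U -> U (Inf y) ->
  exists n, cyl (psource (Inf y)) (pre (Inf y) n) `<=` U.
Proof.
move=> [W WS <-] [A WA Ay].
have [F Fs FA] := WS _ WA.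
suff [n hn] : exists n, cyl (psource (Inf y)) (pre (Inf y) n) `<=` A.
  by exists n => x /hn Ax; exists A.
have basic B : B \in F -> exists n,
    forall m, (n <= m)%N -> cyl (psource (Inf y)) (pre (Inf y) m) `<=` B.
  move=> BF; have By : B (Inf y) by move: Ay; rewrite -FA; apply.
  have [u hu] : cylinders_and_complements B by have := Fs _ BF; rewrite inE.
  exists (size (pedges u)) => m um x.
  have sm : size (pre (Inf y) m) = m by rewrite /= size_mkseq.
  move=> [xs]; rewrite sm => xm.
  have xu : pre x (size (pedges u)) = pre (Inf y) (size (pedges u)).
    by rewrite -(pre_pre x um) xm pre_pre.
  case: hu By => ->; rewrite cylinderE.
    by move=> [ys yp]; split; rewrite ?xs// xu.
  by move=> h [h1 h2]; apply: h; split; rewrite -?xs// -xu.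
have [g hg] : exists g : set (pspace E) -> nat, forall B, B \in F ->
    forall m, (g B <= m)%N -> cyl (psource (Inf y)) (pre (Inf y) m) `<=` B.
  have /choice[g hg] : forall B, exists n, B \in F ->
      forall m, (n <= m)%N -> cyl (psource (Inf y)) (pre (Inf y) m) `<=` B.
    move=> B; have [/basic[n hn]|_] := boolP (B \in F); first by exists n.
    by exists 0%N.
  by exists g.
exists (\max_(B <- F) g B)%N => x xm; rewrite -FA => B /= BF.
by apply: hg xm => //; apply: leq_bigmax_seq.
Qed.

(** Points lying in the same cylinders have the same source and the same prefixes. The prefixes of a
    finite path stop growing, so it cannot share them with an infinite one. *)
Lemma pspace_separated x y : x <> y -> exists v p,
  (cyl v p x /\ ~ cyl v p y) \/ (cyl v p y /\ ~ cyl v p x).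
Proof.
move=> xy; apply: contrapT => h; apply: xy.
have cylE v p : cyl v p x <-> cyl v p y.
  split => c; apply: contrapT => nc; apply: h; exists v, p; [left|right] => //.
have [sy _] := (cylE _ _).1 (cyl_pre x 0).
have preE n : pre x n = pre y n.
  have [_ h1] := (cylE _ _).1 (cyl_pre x n).
  have [_ h2] := (cylE _ _).2 (cyl_pre y n).
  have le (z t : pspace E) : pre z (size (pre t n)) = pre t n ->
    (size (pre t n) <= size (pre z n))%N.
    by move=> e; rewrite -{1}e -(pre_pre _ (size_pre t n)) size_take; case: ltnP => // /ltnW.
  have s : size (pre x n) = size (pre y n).
    by apply/eqP; rewrite eqn_leq !le.
  by rewrite -h1 s -(pre_pre _ (size_pre y n)) take_size.
case: x y sy preE {h cylE} => [w|y] [w'|y'] /= sy preE.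
- congr Fin; apply/val_inj; rewrite /= (surjective_pairing (val w)).
  rewrite (surjective_pairing (val w')); congr (_, _) => //.
  have := preE (maxn (size (pedges w)) (size (pedges w'))).
  by rewrite !take_oversize// ?leq_maxl ?leq_maxr.
- have := congr1 size (preE (size (pedges w)).+1).
  by rewrite size_mkseq take_oversize// => /esym/eqP; rewrite eqn_leq ltnn.
- have := congr1 size (preE (size (pedges w')).+1).
  by rewrite size_mkseq take_oversize// => /eqP; rewrite eqn_leq ltnn.
- case: y y' {sy} preE => [y hy] [y' hy'] /= preE; congr Inf.
  have yy' : y = y'.
    apply/funext => n; have := congr1 (fun s => nth (y n) s n) (preE n.+1).
    by rewrite !nth_mkseq.
  by move: hy hy'; rewrite yy' => hy hy'; congr exist; exact: Prop_irrelevance.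
Qed.

End PathSpace.

(** * Topology and Borel sets of the boundary *)

Section Boundary.
Context {E : digraph} (Rg : set (vert E)).
Implicit Types (x : boundary Rg) (v : vert E) (p : seq (edge E)).

Definition bcyl v p : set (boundary Rg) := set_val @^-1` cyl v p.

Definition bcyls (Q : set (vert E * seq (edge E))) : set (boundary Rg) :=
  \bigcup_(q in Q) bcyl q.1 q.2.

Definition infinite x : Prop := forall n, size (pre (set_val x) n) = n.

Lemma infiniteP x : infinite x <-> exists y, set_val x = Inf y.
Proof.
rewrite /infinite; split => [|[y ->] n]; last by rewrite /= size_mkseq.
case: (set_val x) => [w|y] h; last by exists y.
by have := h (size (pedges w)).+1; rewrite /= take_oversize// => /n_Sn.
Qed.

Lemma open_bcyl v p : open (bcyl v p).
Proof. by exists (cyl v p) => //; exact: open_cyl. Qed.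

Lemma closed_bcyl v p : closed (bcyl v p).
Proof.
rewrite -openC; exists (~` cyl v p) => //.
by rewrite openC; exact: closed_cyl.
Qed.

Lemma open_bcyls Q : open (bcyls Q).
Proof. by apply: bigcup_open => q _; exact: open_bcyl. Qed.

Lemma open_infinite_bcyl (U : set (boundary Rg)) x : open U -> U x ->
  infinite x -> exists n, bcyl (psource (set_val x)) (pre (set_val x) n) `<=` U.
Proof.
move=> [V oV <-] Vx /infiniteP [y xy].
have [|n hn] := open_Inf_cyl (y := y) oV; first by rewrite -xy.
by exists n => z; rewrite /bcyl /= xy => /hn.
Qed.

Lemma hausdorff_boundary : hausdorff_space (boundary Rg).
Proof.
rewrite open_hausdorff => x y /eqP xy.
have sxy : set_val x <> set_val y by move=> /val_inj.
have [v [p [[xA yA]|[yA xA]]]] := pspace_separated sxy.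
- exists (bcyl v p, ~` bcyl v p); first by rewrite !inE.
  split; [exact: open_bcyl|rewrite openC; exact: closed_bcyl|].
  by rewrite /= setICr eqxx.
- exists (~` bcyl v p, bcyl v p); first by rewrite !inE.
  split; [rewrite openC; exact: closed_bcyl|exact: open_bcyl|].
  by rewrite /= setICl eqxx.
Qed.

(** A path has at most one prefix of a given length, so membership in a possibly uncountable union
    becomes a condition on that prefix. *)
Lemma bcylsP n (Q : set (vert E * seq (edge E))) x :
  bcyls [set q | Q q /\ size q.2 = n] x <->
  size (pre (set_val x) n) = n /\ Q (psource (set_val x), pre (set_val x) n).
Proof.
split => [[[v p] [/= Qvp <-]] [sx px]|[sn Qx]]; first by rewrite px sx.
exists (psource (set_val x), pre (set_val x) n) => //; exact: cyl_pre.
Qed.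

Definition recurrent : set (boundary Rg) := set_val @^-1` @recurrent_paths E.

(** The initial segments of a path are determined by their lengths, so infinitely many of them end
    at [v] exactly when their lengths are unbounded. *)
Lemma recurrentP x : recurrent x <-> infinite x /\
  exists v, forall k, exists2 j, (k <= j)%N & vtx (set_val x) j = v.
Proof.
have pre_uniq (u : finpath E) : initseg u (set_val x) ->
    psrc u = psource (set_val x) /\
    pedges u = pre (set_val x) (size (pedges u)).
  by move=> ux; have : cylinder u (set_val x) by []; rewrite cylinderE => -[-> ->].
split => [[/infiniteP ix [v fv]]|[/[dup] ix /infiniteP [y xy] [v hv]]].
  split=> //; exists v => k; apply: contrapT => h; apply: fv.
  have [g hg] : exists g : nat -> finpath E, forall j,
      psrc (g j) = psource (set_val x) /\ pedges (g j) = pre (set_val x) j.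
    have /choice[g hg] : forall j, exists u : finpath E,
        psrc u = psource (set_val x) /\ pedges u = pre (set_val x) j.
      by move=> j; apply: cyl_mk; exact: pre_walk.
    by exists g.
  apply: (@sub_finite_set _ _ (g @` `I_k)); last exact: finite_image.
  move=> u [[/pre_uniq [us up] _] uv]; exists (size (pedges u)); last first.
    have [gs gp] := hg (size (pedges u)).
    apply/val_inj; rewrite [LHS]surjective_pairing [RHS]surjective_pairing.
    congr (_, _); [exact: (etrans gs (esym us))|exact: (etrans gp (esym up))].
  rewrite /= ltnNge; apply/negP => ku; apply: h; exists (size (pedges u)) => //.
  by rewrite /vtx -up -us -uv.
split; first by exists y.
exists v => fin.
have [n hn] : exists n, forall u : finpath E,
    pinitseg u (set_val x) -> ptgt u = v -> (size (pedges u) < n)%N.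
  exists (\max_(u <- fset_set
    [set u : finpath E | pinitseg u (set_val x) /\ ptgt u = v])
      size (pedges u)).+1 => u ux uv.
  by rewrite ltnS; apply: leq_bigmax_seq => //; rewrite in_fset_set// inE.
have [j nj jv] := hv n.
have [u [us up]] := cyl_mk (pre_walk (set_val x) j).
have uj : size (pedges u) = j by rewrite up ix.
have := hn u; rewrite uj ltnNge nj => /(_ _ _)/notF; apply.
  split; last by rewrite xy.
  have : cylinder u (set_val x) by rewrite cylinderE us up; exact: cyl_pre.
  by [].
by rewrite /ptgt us up.
Qed.

Context (x0 : boundary Rg).

Lemma open_measurable_borel (U : set (boundary Rg)) : open U ->
  measurable (U : set (borel x0)).
Proof. exact: sub_sigma_algebra. Qed.

Lemma measurable_infinite : measurable (infinite : set (borel x0)).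
Proof.
rewrite (_ : infinite = \bigcap_n bcyls [set q | setT q /\ size q.2 = n]).
  apply: bigcap_measurable => [|n _]; first by exists 0%N.
  apply: (@open_measurable_borel); exact: open_bcyls.
by apply/seteqP; split => x h n; [move=> _; apply/bcylsP; split=> //; exact: h|
  have /bcylsP[] := h n I].
Qed.

(* Splitting according to the time [n] of some visit to the recurrent vertex
   makes the uncountable union over vertices a countable one. *)
Lemma measurable_recurrent : measurable (recurrent : set (borel x0)).
Proof.
pose A n j : set (boundary Rg) := bcyls
  [set q | pend q.1 q.2 = pend q.1 (take n q.2) /\ size q.2 = j].
have -> : recurrent = infinite `&`
    \bigcup_n \bigcap_k \bigcup_(j in [set j | (n <= j)%N /\ (k <= j)%N]) A n j.
  apply/seteqP; split => x.
    move=> /recurrentP [ix [v hv]]; split => //.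
    have [n _ nv] := hv 0%N; exists n => // k _.
    have [j kj jv] := hv (maxn n k); move: kj; rewrite geq_max => /andP[nj kj].
    exists j => //; apply/(@bcylsP j [set q | pend q.1 q.2 = _]).
    by split => //=; rewrite pre_pre// -/(vtx _ _) jv -nv.
  move=> [ix [n _ h]]; apply/recurrentP; split => //.
  exists (vtx (set_val x) n) => k; have [//|j [nj kj]] := h k.
  move=> /(@bcylsP j [set q | pend q.1 q.2 = _]) [_ /=]; rewrite pre_pre// => e.
  by exists j.
apply: measurableI; first exact: measurable_infinite.
apply: bigcupT_measurable => n; apply: bigcap_measurable => [|k _].
  by exists 0%N.
by apply: bigcup_measurable => j _; apply: (@open_measurable_borel); exact: open_bcyls.
Qed.

End Boundary.

(** * Regularity from inner approximation *)

Section Regularity.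
Context {R : realType} {X : topologicalType} (x0 : X).
Local Open Scope ereal_scope.

Lemma measurable_compact (K : set X) : hausdorff_space X -> compact K ->
  measurable (K : set (borel x0)).
Proof.
move=> hX cK; rewrite -[K]setCK; apply: measurableC.
by apply: sub_sigma_algebra; rewrite /borel_open openC; exact: compact_closed.
Qed.

(** Outer regularity of [A] is inner regularity of its complement: in a Hausdorff space the
    complement of a compact set is open, and the total mass is finite. *)
Lemma inner_regular_regular (mu : probability (borel x0) R) :
  hausdorff_space X ->
  (forall (A : set X) (e : R), measurable (A : set (borel x0)) -> (0 < e)%R ->
    exists K : set X, [/\ compact K, K `<=` A & mu A <= mu K + e%:E]) ->
  regular_measure mu.
Proof.
move=> hX inner A mA; split; apply/eqP; rewrite eq_le; apply/andP; split.
- apply: le_ereal_inf_tmp => _ [U [oU AU] <-].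
  apply: le_measure; rewrite ?inE//; exact: sub_sigma_algebra.
- apply/lee_addgt0Pr => e e0.
  have [K [cK KA muK]] := inner (~` A) e (measurableC mA) e0.
  have mK : measurable (K : set (borel x0)) by exact: measurable_compact.
  apply: (@le_trans _ _ (mu (~` K))).
    apply: ereal_inf_lbound; exists (~` K) => //; split.
      by rewrite openC; exact: compact_closed.
    by move=> x Ax /KA.
  have EA : mu (~` A) = 1 - mu A by exact: probability_setC.
  have EK : mu (~` K) = 1 - mu K by exact: probability_setC.
  have [a aE] : exists a, mu A = a%:E.
    by exists (fine (mu A)); rewrite fineK//; exact: fin_num_measure.
  have [k kE] : exists k, mu K = k%:E.
    by exists (fine (mu K)); rewrite fineK//; exact: fin_num_measure.
  move: muK; rewrite EA EK aE kE -EFinD -!EFinB -!EFinD !lee_fin => h; lra.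
- apply/lee_addgt0Pr => e e0.
  have [K [cK KA muK]] := inner A e mA e0.
  apply: (le_trans muK); rewrite leeD2r//.
  by apply: ereal_sup_ubound; exists K.
- apply: ge_ereal_sup => _ [K [cK KA] <-].
  by apply: le_measure; rewrite ?inE//; exact: measurable_compact.
Qed.

End Regularity.

(** * Associated measures and recurrence *)

Section Measures.
Context {R : realType} {E : digraph} (Rg : set (vert E)) (x0 : boundary Rg).
Context (mu : probability (borel x0) R).
Implicit Types (v : vert E) (p : seq (edge E)) (Q : set (vert E * seq (edge E))).
Local Open Scope ereal_scope.

Lemma measurable_bcyl v p : measurable (bcyl (Rg := Rg) v p : set (borel x0)).
Proof. apply: (@open_measurable_borel); exact: open_bcyl. Qed.

Lemma measurable_bcyls Q : measurable (bcyls (Rg := Rg) Q : set (borel x0)).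
Proof. apply: (@open_measurable_borel); exact: open_bcyls. Qed.

Lemma le_measure_bigsetU (I : Type) (s : seq I) (F : I -> set (borel x0)) :
  (forall i, measurable (F i)) ->
  mu (\big[setU/set0]_(i <- s) F i) <= \sum_(i <- s) mu (F i).
Proof.
move=> mF; elim: s => [|i s IH]; first by rewrite !big_nil measure0.
rewrite !big_cons; apply: le_trans (measureU2 _ _ _) _ => //.
  by apply: bigsetU_measurable.
by rewrite leeD2l.
Qed.

(* The union may be uncountable: compactness reduces it to finite unions. *)
Lemma measure_bcyls_le Q : regular_measure mu ->
  mu (bcyls Q) <= \esum_(q in Q) mu (bcyl q.1 q.2).
Proof.
move=> reg; have [_ ->] := reg _ (measurable_bcyls Q).
apply: ge_ereal_sup => _ [C [cC CQ] <-].
pose T : ptopologicalType := HB.pack (set_type (boundary Rg))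
  (isPointed.Build (set_type (boundary Rg)) x0).
have cC' : @compact T C by exact: cC.
move: cC'; rewrite compact_cover => /(_ _ Q (fun q => bcyl q.1 q.2)) [].
- by move=> q _; exact: open_bcyl.
- exact: CQ.
move=> F FQ CF.
have mC : measurable (C : set (borel x0)).
  by apply: measurable_compact cC; exact: hausdorff_boundary.
apply: (@le_trans _ _ (\sum_(q <- F) mu (bcyl q.1 q.2))); last first.
  apply: ereal_sup_ubound; exists [set` F].
    by split => // q /FQ; rewrite inE.
  by rewrite fsbig_finite//= set_fsetK.
apply: le_trans (le_measure_bigsetU _ _); last by move=> q; exact: measurable_bcyl.
apply: le_measure; rewrite ?inE//.
  by apply: bigsetU_measurable => q _; exact: measurable_bcyl.
by rewrite -bigcup_seq.
Qed.

(** Every finite partial sum is the measure of a finite disjoint union, even when [Q] is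
    uncountable. *)
Lemma measure_bcyls_ge Q :
  (forall q q' (x : boundary Rg), Q q -> Q q' ->
    bcyl q.1 q.2 x -> bcyl q'.1 q'.2 x -> q = q') ->
  \esum_(q in Q) mu (bcyl q.1 q.2) <= mu (bcyls Q).
Proof.
move=> disj; apply: ge_ereal_sup => _ [X [finX XQ] <-].
rewrite -(@measure_fin_bigcup _ _ _ mu _ X (fun q => bcyl q.1 q.2))//.
- apply: le_measure; rewrite ?inE//.
  + by apply: fin_bigcup_measurable => // q _; exact: measurable_bcyl.
  + exact: measurable_bcyls.
  + exact: bigcup_subset.
- by move=> q q' Xq Xq' [x [xq xq']]; apply: disj xq xq'; exact: XQ.
- by move=> q _; exact: measurable_bcyl.
Qed.

Context (N : edge E -> R) (beta : R) (m : vert E -> R).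
Let K e := (N e `^ (- beta))%R.
Hypothesis am : associated_measure N beta m mu.

Lemma econs_pre e (x y : pspace E) : econs e x y ->
  [/\ psource x = tgt e, psource y = src e & forall n, pre y n.+1 = e :: pre x n].
Proof.
case: x y => [u|x] [w|y] //=; first by move=> [us ws we]; split => // n; rewrite we.
move=> [xs y0 yn]; split=> // [|n]; first by rewrite y0.
rewrite /mkseq /= y0; congr (_ :: _).
by rewrite (iotaDl 1 0) -map_comp; apply: eq_map => i /=; rewrite yn.
Qed.

Lemma econs_bcyl e p :
  [set y | exists2 x, bcyl (Rg := Rg) (tgt e) p x & econs e (set_val x) (set_val y)] =
  bcyl (Rg := Rg) (src e) (e :: p).
Proof.
apply/seteqP; split => [y [x [xs xp]] /econs_pre [_ ys yp]|y [ys yp]].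
  by split => //=; rewrite yp xp.
(* The witness is [y] without its first edge. It stays in the boundary: an infinite path remains
   infinite, and a finite one keeps its range. *)
have [x [xB xy]] : exists x, boundary Rg x /\ econs e x (set_val y) /\
    cyl (tgt e) p x.
  have By : boundary Rg (set_val y) by exact: set_valP.
  case: (set_val y) By ys yp => [w|y'] By ys yp.
    have {}By : ~ Rg (ptgt w) by case: By => [[]//|[u [->]]].
    case: w By ys yp => -[v q] wq /= Bw ev.
    rewrite /pedges /=; case: q wq Bw ev => [//|f q] wq Bw ev /= [fe qp].
    have wq' : walk (tgt e) q by move: (wq); rewrite /= fe => /andP[].
    exists (Fin (exist _ (tgt e, q) wq')); split.
      by right; exists (exist _ (tgt e, q) wq') => //; move: Bw; rewrite /ptgt /= fe.
    by split => //; split => //; rewrite /pedges /= fe.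
  have y0 : sval y' 0%N = e by case: yp.
  have hx n : tgt (sval y' n.+1) = src (sval y' n.+2) by exact: (svalP y').
  exists (Inf (exist _ (fun n => sval y' n.+1) hx)); split; first by left; eexists.
  have s1 : src (sval y' 1%N) = tgt e by rewrite -(svalP y') y0.
  split => //; split => //=.
  by case: yp => _; rewrite (iotaDl 1 0) -map_comp.
exists (exist _ x (mem_set xB)); first by case: xy.
by case: xy.
Qed.

Lemma measure_bcyl v p : walk v p ->
  mu (bcyl v p) = (wt K p * m (pend v p))%:E.
Proof.
have [reg mv scale] := am.
elim: p v => [|e p IH] v /=.
  move=> _; rewrite /wt big_nil mul1r /pend /= -mv cylinderE//.
move=> /andP[/eqP <- wp]; rewrite -econs_bcyl scale.
- by rewrite IH// wt_cons -EFinM mulrA.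
- exact: measurable_bcyl.
- move=> x [xs xp]; rewrite cylinderE; split => //=.
  by case: (set_val x) => [w|y] //=; rewrite take0.
Qed.

End Measures.

Lemma negligible_countable_bigcup d (T : measurableType d) (R : realType)
    (mu : {measure set T -> \bar R}) (I : Type) (D : set I) (F : I -> set T) :
  countable D -> (forall i, D i -> mu.-negligible (F i)) ->
  mu.-negligible (\bigcup_(i in D) F i).
Proof.
move=> /countable_injP[g ginj] nF.
rewrite (_ : \bigcup_(i in D) F i =
    \bigcup_n \bigcup_(i in [set i | D i /\ g i = n]) F i).
  apply: negligible_bigcup => n.
  have [[i [Di gi]]|nD] := pselect (exists i, D i /\ g i = n).
    rewrite (_ : \bigcup_(_ in _) _ = F i); first exact: nF.
    apply/seteqP; split => x; last by move=> Fx; exists i.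
    move=> [j [Dj gj] Fj].
    by rewrite (ginj i j) ?inE// gi gj.
  rewrite (_ : \bigcup_(_ in _) _ = set0); first exact: negligible_set0.
  by apply/seteqP; split => x // [j Dj _]; apply: nD; exists j.
apply/seteqP; split => x [i]; first by move=> Di Fi; exists (g i) => //; exists i.
by move=> _ [j [Dj _] Fj]; exists j.
Qed.

(** * Recurrent paths and critical vertices *)

Section Recurrence.
Context {R : realType} {E : digraph} (Rg : set (vert E)).
Context (N : edge E -> R) (beta : R).
Hypothesis N_gt0 : forall e, (0 < N e)%R.
Local Open Scope ereal_scope.

Let K e := (N e `^ (- beta))%R.

Let K_gt0 e : (0 < K e)%R. Proof. exact: powR_gt0. Qed.

Lemma Dbeta_superharmonic m : Dbeta Rg N beta m ->
  superharmonic K (fun v => (m v)%:E).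
Proof.
move=> [m01 _ _ ms]; split => v; first by rewrite lee_fin; have /andP[] := m01 v.
apply: le_trans (ms v); rewrite le_eqVlt; apply/orP; left; apply/eqP.
by apply: eq_esum => e _; rewrite EFinM.
Qed.

Context (x0 : boundary Rg) (mu : probability (borel x0) R) (m : vert E -> R).
Hypothesis m_Dbeta : Dbeta Rg N beta m.
Hypothesis am : associated_measure N beta m mu.

Let f v := (m v)%:E.

Let fs : superharmonic K f. Proof. exact: Dbeta_superharmonic. Qed.

Let f_ge0 v : 0 <= f v. Proof. exact: fs.1. Qed.

(** The bridge from measures to potential theory: families of cylinders cut out by [walk_to] have
    walk sums of [m] as total measure. *)
Lemma esum_measure_bcyl L D B :
  \esum_(q in [set q | walk_to D B q.1 q.2 /\ L (size q.2)])
    mu (bcyl q.1 q.2) = \esum_(v in [set: vert E]) walk_sum K L D B f v.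
Proof.
rewrite -esum_walk_sum//; apply: eq_esum => -[v p] /= [/walk_to_walk wp _].
by rewrite (measure_bcyl am)// EFinM.
Qed.

Lemma visitP D B j (x : boundary Rg) :
  bcyls [set q | walk_to D B q.1 q.2 /\ [set j] (size q.2)] x <->
  size (pre (set_val x) j) = j /\
    walk_to D B (psource (set_val x)) (pre (set_val x) j).
Proof. exact: (bcylsP j [set q | walk_to D B q.1 q.2]). Qed.

(* Borel-Cantelli: [green_le] makes the expected number of visits to [v] finite. *)
Lemma infinitely_often_null v : (0 < m v)%R -> ~ crit K v ->
  mu (lim_sup_set (fun j =>
    bcyls [set q | walk_to setT [set v] q.1 q.2 /\ [set j] (size q.2)])) = 0.
Proof.
move=> mv0 ncv; have [reg _ _] := am; have [m01 m1 _ _] := m_Dbeta.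
(* A positive [m v] bounds [tot K v], as [m v * tot K v] is at most the total mass 1. Not being
   critical then means [ret K v < 1], so [d] below is positive. *)
have totv : tot K v < +oo.
  have : f v * tot K v <= 1.
    by rewrite -m1; apply: (mass_le K_gt0 fs); rewrite ltry.
  rewrite ltNge leye_eq => h; apply/negP => /eqP tv; move: h.
  by rewrite tv gt0_muley ?lte_fin// leye_eq.
have r1 : ret K v <= 1 by apply: (ret_le1 K_gt0 fs); rewrite ?lte_fin ?ltry.
have r0 : 0 <= ret K v by apply: step_ge0 => // w; exact: hit_ge0.
have rf : ret K v \is a fin_num by rewrite ge0_fin_numE// (le_lt_trans r1)// ltry.
pose d := (1 - fine (ret K v))%R.
have d0 : (0 < d)%R.
  rewrite subr_gt0 lt_neqAle -lee_fin fineK// r1 andbT.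
  apply/eqP => r; apply: ncv; split => //.
  by rewrite -(fineK rf) r.
have dr : d%:E + ret K v <= 1 by rewrite -(fineK rf) -EFinD /d subrK.
apply: lim_sup_set_cvg0 => [j|]; first exact: measurable_bcyls.
apply: (@le_lt_trans _ _ (f v * ((d^-1)%:E * tot K v))); last first.
  by rewrite lte_mul_pinfty ?f_ge0// lte_mul_pinfty// lee_fin invr_ge0 ltW.
rewrite nneseries_esumT => [|j]; last exact: measure_ge0.
have g0 (w : vert E) : 0 <= cst (f v) w by exact: f_ge0.
apply: (@le_trans _ _ (\esum_(j in [set: nat]) \esum_(w in [set: vert E])
    walk_sum K [set j] setT [set v] (cst (f v)) w)).
  apply: le_esum => j _; apply: le_trans (measure_bcyls_le _ reg) _.
  rewrite esum_measure_bcyl; apply: le_esum => w _.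
  by rewrite (@eq_walk_sum _ _ K _ _ _ f (cst (f v)))// => _ ->.
rewrite esum_exchange => [|j w]; last exact: walk_sum_ge0.
rewrite /tot -!esumZl ?invr_ge0 ?(ltW d0) ?(ltW mv0)//; first last.
- by move=> w; exact: hit_ge0.
- by move=> w; rewrite mule_ge0 ?lee_fin ?invr_ge0 ?(ltW d0)// hit_ge0.
apply: le_esum => w _; rewrite walk_sum_size//.
have -> : walk_sum K setT setT [set v] (cst (f v)) w =
    f v * walk_sum K setT setT [set v] (cst 1) w.
  rewrite -walk_sumZ// ?(ltW mv0)//; congr (walk_sum _ _ _ _ _ w).
  by apply/funext => u; rewrite mule1.
rewrite lee_wpmul2l ?f_ge0//.
have := green_le K_gt0 w (ltW d0) dr.
by rewrite -lee_pdivlMl// => h; rewrite (le_trans h)// muleC.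
Qed.

(** A vertex that the path visits infinitely often is of one of three kinds. If it is critical, the
    path lies in [bcyls QC]. If [m] vanishes there, the path lies in [bcyls Q0], null by regularity
    even for uncountably many such vertices. The remaining ones have positive [m], so there are
    countably many, and each contributes a null set. *)
Lemma recurrent_mass : mu (recurrent (Rg := Rg)) = 1 ->
  1 <= \esum_(v in [set: vert E]) walk_sum K setT (~` crit K) (crit K) f v.
Proof.
move=> mu1; have [reg _ _] := am; have [m01 m1 _ _] := m_Dbeta.
pose QC := [set q : vert E * seq (edge E) |
  walk_to (~` crit K) (crit K) q.1 q.2 /\ [set: nat] (size q.2)].
pose Q0 := [set q : vert E * seq (edge E) |
  walk_to setT [set v | m v = 0%R] q.1 q.2 /\ [set: nat] (size q.2)].
pose V := [set v | (0 < m v)%R /\ ~ crit K v].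
pose S v := lim_sup_set (fun j => bcyls (Rg := Rg)
  [set q | walk_to setT [set v] q.1 q.2 /\ [set j] (size q.2)]).
have mS v : measurable (S v : set (borel x0)).
  apply: bigcap_measurable => [|n _]; first by exists 0%N.
  by apply: bigcup_measurable => j _; exact: measurable_bcyls.
have cV : countable V.
  apply: sub_countable (countable_esum (A := setT) (a := f) f_ge0 _); last first.
    by rewrite m1 ltry.
  apply: subset_card_le => v [mv _]; split => //.
have [Z [mZ Z0 SZ]] : mu.-negligible (\bigcup_(v in V) S v).
  apply: negligible_countable_bigcup => // v [mv0 ncv].
  by exists (S v); split => //; exact: infinitely_often_null.
have mu0 : mu (bcyls Q0) = 0.
  apply/eqP; rewrite eq_le measure_ge0 andbT.
  apply: le_trans (measure_bcyls_le _ reg) _; rewrite esum_measure_bcyl esum1// => v _.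
  by apply: esum1 => p [/walk_to_end /= mp _]; rewrite /f mp mule0.
rewrite -mu1; apply: (@le_trans _ _ (mu (bcyls QC `|` (bcyls Q0 `|` Z)))).
  apply: le_measure; rewrite ?inE; first exact: measurable_recurrent.
    by do 2![apply: measurableU => //; first exact: measurable_bcyls].
  move=> x /recurrentP [ix [v hv]].
  have visit j : vtx (set_val x) j = v -> forall B : set (vert E), B v ->
      walk_to setT B (psource (set_val x)) (pre (set_val x) j).
    by move=> jv B Bv; apply: walk_toT; [exact: pre_walk|rewrite -/(vtx _ _) jv].
  have [cv|ncv] := pselect (crit K v).
    left; have [j _ jv] := hv 0%N.
    have [|n hn] := walk_to_first (B := crit K) (pre_walk (set_val x) j).
      by rewrite -/(vtx _ _) jv.
    exists (psource (set_val x), take n (pre (set_val x) j)) => //.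
    by apply: cyl_take; exact: cyl_pre.
  right; have [mv0|mv0] := eqVneq (m v) 0%R.
    left; have [j _ jv] := hv 0%N.
    exists (psource (set_val x), pre (set_val x) j); last exact: cyl_pre.
    by split => //; exact: visit.
  right; apply: SZ; exists v.
    by split => //; rewrite lt_neqAle eq_sym mv0; have /andP[] := m01 v.
  move=> n _; have [j nj jv] := hv n; exists j => //.
  by apply/visitP; split; [exact: ix|exact: visit].
apply: (@le_trans _ _ (mu (bcyls QC))); last first.
  by apply: le_trans (measure_bcyls_le _ reg) _; rewrite esum_measure_bcyl.
rewrite measureU0//; first exact: measurable_bcyls.
  by apply: measurableU => //; exact: measurable_bcyls.
apply/eqP; rewrite eq_le measure_ge0 andbT.
have : mu (bcyls Q0 `|` Z) <= mu (bcyls Q0) + mu Z.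
  by apply: measureU2 => //; exact: measurable_bcyls.
by rewrite [X in _ <= X + _]mu0 [X in _ <= _ + X]Z0 adde0.
Qed.

(** Extending a walk to a critical vertex by all first returns multiplies its mass by [ret], which
    is 1. So the upper bound for the visits at time [j] equals the lower bound for those followed by
    a return. *)
Lemma never_return_null j :
  mu (bcyls [set q | walk_to setT (crit K) q.1 q.2 /\ [set j] (size q.2)] `\`
    bcyls [set q | exists p l, [/\ walk_to setT (crit K) q.1 p, size p = j,
      first_returns (pend q.1 p) l & q.2 = p ++ l]]) = 0.
Proof.
have [reg _ _] := am; have [_ m1 _ _] := m_Dbeta.
set QU := [set q | _ /\ _]; set QR := [set q | exists p l, _].
have mU : measurable (bcyls QU : set (borel x0)) by exact: measurable_bcyls.
have mR : measurable (bcyls QR : set (borel x0)) by exact: measurable_bcyls.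
have RU : bcyls (Rg := Rg) QR `<=` bcyls QU.
  move=> x [[v p] [p1 [l /= [wp sp _ ->]]] hx]; exists (v, p1); first by split.
  by have := cyl_take (size p1) hx; rewrite take_size_cat.
pose A := [set q : vert E * seq (edge E) |
  walk_to setT (crit K) q.1 q.2 /\ [set j] (size q.2)].
pose e (ql : (vert E * seq (edge E)) * seq (edge E)) := (ql.1.1, ql.1.2 ++ ql.2).
pose P := A `*`` (fun q => first_returns (pend q.1 q.2)).
have QRE : QR = e @` P.
  apply/seteqP; split => [[v p] [p1 [l /= [wp sp rl ->]]]|].
    by exists ((v, p1), l).
  by move=> _ [[[v p] l] [[/= wp sp] rl] <-]; exists p, l.
have einj : set_inj P e.
  move=> [[v p] l] [[w q] k]; rewrite !inE => -[[/= _ sp] _] [[/= _ sq] _] [-> pq].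
  have : take j (p ++ l) = take j (q ++ k) by rewrite pq.
  rewrite -{1}sp -sq !take_size_cat// => pq'; move: pq; rewrite pq' => /eqP.
  by rewrite eqseq_cat// eqxx => /eqP ->.
have le : mu (bcyls QU) <= mu (bcyls QR).
  apply: le_trans (measure_bcyls_le _ reg) _.
  apply: le_trans (measure_bcyls_ge _ _); last first.
    move=> [v p] [w q] x [p1 [l /= [wp sp rl ->]]] [q1 [k /= [wq sq rk ->]]].
    move=> /[dup] h1 [vx px] /[dup] h2 [wx qx]; rewrite -vx wx.
    (* Disjointness: both words agree up to time [j], and of two returns along the same path the
       longer extends the shorter, so the antichain property makes them equal. *)
    have pq1 : p1 = q1.
      have [_] := cyl_take (size p1) h1; have [_] := cyl_take (size q1) h2.
      by rewrite !take_size_cat// sp sq => -> ->.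
    rewrite -vx wx -pq1 in rl rk; rewrite -pq1 in h2.
    congr (_, _ ++ _) => //.
    have [le|le] := leqP (size l) (size k).
      have [|_] := cyl_comparable h1 h2; first by rewrite !size_cat leq_add2l.
      rewrite !size_cat take_cat ltnNge leq_addr /= addKn => /eqP.
      rewrite eqseq_cat// eqxx /= => /eqP lk; rewrite -(cat_take_drop (size l) k) -lk in rk.
      have := first_returns_antichain rl rk.
      by move=> d; rewrite -[RHS](cat_take_drop (size l)) -lk d cats0.
    have [|_] := cyl_comparable h2 h1; first by rewrite !size_cat leq_add2l ltnW.
    rewrite !size_cat take_cat ltnNge leq_addr /= addKn => /eqP.
    rewrite eqseq_cat// eqxx /= => /eqP lk; rewrite -(cat_take_drop (size k) l) -lk in rl.
    have := first_returns_antichain rk rl.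
    by move=> d; rewrite -[LHS](cat_take_drop (size k)) -lk d cats0.
  rewrite QRE esum_image// -/A.
  rewrite -(@esum_esum _ _ _ A (fun q => first_returns (pend q.1 q.2))
    (fun q l => mu (bcyl q.1 (q.2 ++ l))))//.
  apply: le_esum => -[v p] [/= wp sp]; have cp := walk_to_end wp.
  have vp := walk_to_walk wp.
  rewrite (@eq_esum _ _ _ _ (fun l => (wt K p * m (pend v p))%:E * (wt K l)%:E)).
    rewrite esumZl ?mulr_ge0 ?wt_ge0 ?fine_ge0//; last 2 first.
    - exact: f_ge0.
    - by move=> l; rewrite lee_fin wt_ge0.
    by rewrite -retE// cp.2 mule1 (measure_bcyl am).
  move=> l rl; have [wl pl _] := first_returns_walk rl.
  rewrite (measure_bcyl am); last by rewrite walk_cat vp wl.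
  by rewrite pend_cat pl wt_cat -EFinM mulrAC.
rewrite measureD//; last by rewrite (le_lt_trans (probability_le1 _ _))// ltry.
rewrite (_ : bcyls QU `&` bcyls QR = bcyls QR); last exact/setIidPr.
apply/eqP; rewrite eq_le sube_le0 le/=.
have fR : mu (bcyls QR) \is a fin_num by exact: fin_num_measure.
by rewrite sube_ge0 ?fR// le_measure// inE.
Qed.

Lemma recurrent_full : mu (infinite (Rg := Rg)) = 1 ->
  1 <= \esum_(v in [set: vert E]) walk_sum K setT (~` crit K) (crit K) f v ->
  mu (recurrent (Rg := Rg)) = 1.
Proof.
move=> mui le1.
pose QC := [set q : vert E * seq (edge E) |
  walk_to (~` crit K) (crit K) q.1 q.2 /\ [set: nat] (size q.2)].
pose U j := bcyls (Rg := Rg)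
  [set q | walk_to setT (crit K) q.1 q.2 /\ [set j] (size q.2)].
pose V j := bcyls (Rg := Rg)
  [set q | exists p l, [/\ walk_to setT (crit K) q.1 p, size p = j,
      first_returns (pend q.1 p) l & q.2 = p ++ l]].
have muC : mu (bcyls QC) = 1.
  apply/eqP; rewrite eq_le probability_le1/=; last exact: measurable_bcyls.
  apply: le_trans le1 _; rewrite -esum_measure_bcyl; apply: measure_bcyls_ge.
  move=> [v p] [w q] x [/= wp _] [/= wq _] h1 h2.
  have [le|/ltnW le] := leqP (size p) (size q).
    have [vw pq] := cyl_comparable h1 h2 le.
    rewrite vw in wp *; rewrite -(cat_take_drop (size p) q) -pq in wq *.
    by rewrite (walk_to_antichain wp wq) cats0.
  have [vw pq] := cyl_comparable h2 h1 le.
  rewrite vw in wq *; rewrite -(cat_take_drop (size q) p) -pq in wp *.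
  by rewrite (walk_to_antichain wq wp) cats0.
have co (A : set (borel x0)) : measurable A -> mu A = 1 -> mu.-negligible (~` A).
  move=> mA A1; exists (~` A); split => //; first exact: measurableC.
  by rewrite probability_setC// A1 subee.
have neg : mu.-negligible (~` (infinite (Rg := Rg)) `|`
    (~` bcyls QC `|` \bigcup_j (U j `\` V j))).
  apply: negligibleU; first exact: (co _ (@measurable_infinite _ _ x0) mui).
  apply: negligibleU.
    exact: (co _ (@measurable_bcyls _ _ x0 QC) muC).
  apply: negligible_bigcup => j; exists (U j `\` V j); split => //.
    by apply: measurableD; exact: measurable_bcyls.
  exact: never_return_null.
have : mu.-negligible (~` (recurrent (Rg := Rg))).
  apply: negligibleS neg => x nrx.
  apply: contrapT => /not_orP [/contrapT ix /not_orP [/contrapT [[v p] [/= wp _] vpx] nU]].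
  apply: nrx; apply/recurrentP; split => //.
  have [pv pp] := vpx; have := walk_to_end wp; rewrite -pv -pp => cw.
  (* Outside one null set, every visit to a critical vertex is followed by a return to that vertex.
     Return words are nonempty, so the visiting time grows by at least 1 at each round. *)
  exists (vtx (set_val x) (size p)); elim=> [|k [j kj jw]]; first by exists (size p).
  have Uj : U j x.
    apply/visitP; split; first exact: ix.
    by apply: walk_toT; [exact: pre_walk|rewrite -/(vtx _ _) jw].
  have Vj : V j x by apply: contrapT => nV; apply: nU; exists j.
  have [[w q] [p1 [l /= [wp1 sp1 rl ->]]] hx] := Vj.
  have [wl pl l0] := first_returns_walk rl.
  exists (j + size l)%N.
    by rewrite -addn1 leq_add//; case: (l) l0.
  have [xw xq] := hx; have [_] := cyl_take (size p1) hx.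
  rewrite take_size_cat// sp1 => xp1; move: xq; rewrite size_cat sp1 => xq.
  by rewrite -jw /vtx xw xq pend_cat pl xp1.
move=> /negligibleP h; have mrec := @measurable_recurrent _ Rg x0.
have z : mu (~` (recurrent (Rg := Rg))) = 0 by apply: h; exact: measurableC.
have : mu (~` (recurrent (Rg := Rg))) = 1 - mu (recurrent (Rg := Rg)).
  exact: (probability_setC mu mrec).
rewrite z => /esym/eqP; rewrite sube_eq//.
by rewrite add0e => /eqP ->.
Qed.

End Recurrence.

(** * Path measures from nested intervals *)

Lemma measure_countable_bigcup d (T : measurableType d) (R : realType)
    (mu : {measure set T -> \bar R}) (I : choiceType) (D : set I) (F : I -> set T) :
  countable D -> (forall i, D i -> measurable (F i)) -> trivIset D F ->
  (measurable (\bigcup_(i in D) F i) /\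
  mu (\bigcup_(i in D) F i) = \esum_(i in D) mu (F i))%E.
Proof.
move=> /countable_injP[g ginj] mF tF.
have [->|/set0P [i0 Di0]] := eqVneq D set0.
  by rewrite bigcup_set0 measure0 esum_set0.
(* [h] inverts the enumeration [g] on its image; elsewhere it takes the arbitrary value [i0]. *)
have [h hg] : exists h : nat -> I, forall i, D i -> h (g i) = i.
  have /choice[h hP] : forall n, exists i, forall j, D j -> g j = n -> i = j.
    move=> n; have [[i [Di <-]]|nD] := pselect (exists i, D i /\ g i = n).
      by exists i => j Dj ij; apply: ginj => //; rewrite inE.
    by exists i0 => j Dj jn; exfalso; apply: nD; exists j.
  by exists h => i Di; exact: hP.
have E : \bigcup_(i in D) F i = \bigcup_(n in g @` D) F (h n).
  apply/seteqP; split => x [i].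
    by move=> Di Fi; exists (g i); [exists i|rewrite hg].
  by move=> [j Dj <-]; rewrite hg// => Fj; exists j.
have mFh n : (g @` D) n -> measurable (F (h n)).
  by move=> [j Dj <-]; rewrite hg//; exact: mF.
rewrite E; split; first exact: bigcup_measurable.
rewrite measure_bigcup//; last first.
  move=> _ _ [i Di <-] [j Dj <-]; rewrite !hg// => Fij; congr g.
  exact: tF Fij.
rewrite nneseries_esum => [|n _]; last exact: measure_ge0.
rewrite (_ : [set x | x \in g @` D] = g @` D); last by apply/seteqP; split => x; rewrite /= inE.
rewrite esum_image//.
by apply: eq_esum => i Di; rewrite hg.
Qed.

(** * Nested partitions of an interval *)

Section IntervalTree.
Context {R : realType} {T : choiceType}.

(** The intervals are laid end to end in the order of an enumeration [g] of [S]: that of [e] starts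
    at the total length of the indices enumerated before it. Indices of length 0 receive empty
    intervals. *)
Lemma interval_partition (S : set T) (q : T -> R) (L : R) : countable S ->
  (forall e, 0 <= q e) -> (forall e, 0 < q e -> S e) ->
  (\esum_(e in [set: T]) (q e)%:E = L%:E)%E ->
  exists c : T -> R,
    (forall t, 0 <= t < L <-> exists e, c e <= t < c e + q e) /\
    (forall t e e', c e <= t < c e + q e -> c e' <= t < c e' + q e' -> e = e').
Proof.
move=> /countable_injP[g ginj] q0 qS qL.
have qe0 e : (0 <= (q e)%:E)%E by rewrite lee_fin.
pose G n := (\esum_(e in [set e | S e /\ (g e < n)%N]) (q e)%:E)%E.
have GL n : (G n <= L%:E)%E by rewrite -qL; exact: esum_le_sub.
have G0 n : (0 <= G n)%E by exact: esum_ge0.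
have Gf n : G n \is a fin_num by rewrite ge0_fin_numE// (le_lt_trans (GL n))// ltry.
have [H HE] : exists H : nat -> R, forall n, (H n)%:E = G n.
  by exists (fun n => fine (G n)) => n; rewrite fineK.
have G00 : G 0%N = 0%E.
  by rewrite /G (_ : mkset _ = set0) ?esum_set0//; apply/seteqP; split => // e [].
have Gmon n k : (n <= k)%N -> (G n <= G k)%E.
  move=> nk; apply: esum_le_sub => e [Se ge]; split => //; exact: leq_trans nk.
have GS e : S e -> G (g e).+1 = (G (g e) + (q e)%:E)%E.
  move=> Se; rewrite /G (esumID [set e])//= addeC; congr (_ + _)%E.
    congr esum; apply/seteqP; split => e' /=.
      move=> [[Se']]; rewrite ltnS leq_eqVlt => /orP[/eqP gg|//] ee; exfalso.
      by apply: ee; apply: ginj; rewrite ?inE.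
    move=> [Se' ge']; split; first by split => //; exact: ltnW.
    by move=> ee; rewrite ee ltnn in ge'.
  rewrite (_ : _ `&` _ = [set e]) ?esum_set1//.
  by apply/seteqP; split => e' /=; [case|move=> ->; rewrite ltnS leqnn].
have Gno n : ~ (exists2 e, S e & g e = n) -> G n.+1 = G n.
  move=> no; rewrite /G; congr esum; apply/seteqP; split => e' /=.
    move=> [Se']; rewrite ltnS leq_eqVlt => /orP[/eqP gg|//]; exfalso.
    by apply: no; exists e'.
  by move=> [Se' ge']; split => //; exact: ltnW.
have HS e : S e -> H (g e).+1 = H (g e) + q e.
  by move=> Se; apply: EFin_inj; rewrite EFinD !HE GS.
have inS t e : H (g e) <= t < H (g e) + q e -> S e.
  move=> /andP[h1 h2]; apply: qS; rewrite -(ltrD2l (H (g e))) addr0.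
  exact: le_lt_trans h2.
exists (fun e => H (g e)); split => [t|t e e' h h']; last first.
  have Se := inS _ _ h; have Se' := inS _ _ h'.
  move: h h'; rewrite -!HS// => /andP[h1 h2] /andP[h3 h4].
  have mon n k : (n <= k)%N -> H n <= H k by move=> nk; rewrite -lee_fin !HE Gmon.
  have [lt|lt|gg] := ltngtP (g e) (g e').
  - by have := lt_le_trans h2 (le_trans (mon _ _ lt) h3); rewrite ltxx.
  - by have := lt_le_trans h4 (le_trans (mon _ _ lt) h1); rewrite ltxx.
  - by apply: ginj gg; rewrite inE.
split => [/andP[t0 tL]|[e /[dup] /inS Se /andP[h1 h2]]]; last first.
  apply/andP; split; first by apply: le_trans h1; rewrite -lee_fin HE.
  by apply: (lt_le_trans h2); rewrite -HS// -lee_fin HE.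
have [n tn] : exists n, t < H n.
  have : (t%:E < \esum_(e in S) (q e)%:E)%E.
    rewrite esum_mkcond (_ : (\esum_(_ in _) _)%E = L%:E) ?lte_fin// -qL.
    apply: eq_esum => e _; case: ifPn => //; rewrite notin_setE => nS.
    congr EFin; apply/esym/eqP; rewrite eq_le q0 andbT leNgt.
    by apply/negP => /qS.
  move=> /ereal_sup_gt[_ [X [finX XS] <-] tX].
  exists (\max_(e <- fset_set X) g e).+1; rewrite -lte_fin HE.
  apply: (lt_le_trans tX); apply: ereal_sup_ubound; exists X => //; split => //.
  move=> e Xe; split; first exact: XS.
  by rewrite ltnS; apply: leq_bigmax_seq => //; rewrite in_fset_set// inE.
(* The least partial sum beyond [t] is not the zeroth, and its last step adds some index, because
   partial sums are constant across numbers that [g] does not attain. *)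
have [k tk kmin] := ex_minnP (ex_intro (fun n => t < H n) n tn).
case: k tk kmin => [|k] tk kmin.
  by move: tk; rewrite -lte_fin HE G00 lte_fin ltNge t0.
have Hkt : H k <= t by rewrite leNgt; apply/negP => /kmin; rewrite ltnn.
have [[e Se gk]|no] := pselect (exists2 e, S e & g e = k); last first.
  by move: tk; rewrite -lte_fin HE Gno// -HE lte_fin ltNge Hkt.
by exists e; rewrite -HS// gk Hkt.
Qed.

Context (w : seq T -> R) (S : set T) (e0 : T).
Hypothesis S_count : countable S.
Hypothesis w_ge0 : forall p, 0 <= w p.
Hypothesis w_nil : w [::] = 1.
Hypothesis w_S : forall p e, 0 < w (rcons p e) -> S e.
Hypothesis w_rcons :
  forall p, (\esum_(e in [set: T]) (w (rcons p e))%:E = (w p)%:E)%E.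

(** Each interval is partitioned among its children, so a point of [[0, 1[] selects exactly one
    child at every level, and these choices form the sequence [g t]. *)
Lemma interval_tree : exists (a : seq T -> R) (g : R -> nat -> T),
  (forall t p, a p <= t < a p + w p -> 0 <= t < 1) /\
  forall t p, 0 <= t < 1 ->
    (mkseq (g t) (size p) = p <-> a p <= t < a p + w p).
Proof.
have /choice[c cP] : forall p, exists c : T -> R,
    (forall t, 0 <= t < w p <-> exists e, c e <= t < c e + w (rcons p e)) /\
    (forall t e e', c e <= t < c e + w (rcons p e) ->
       c e' <= t < c e' + w (rcons p e') -> e = e').
  by move=> p; apply: (@interval_partition S) => // e; exact: w_S.
(* [c pre e] is the offset of child [e] inside the interval of [pre]; the left endpoint of [p] adds
   up these offsets along [p]. *)
pose fix aux pre p := if p is e :: p' then c pre e + aux (rcons pre e) p' else 0.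
pose a p := aux [::] p.
have auxE pre p e : aux pre (rcons p e) = aux pre p + c (pre ++ p) e.
  elim: p pre => [|f p IH] pre /=; first by rewrite cats0 addr0 add0r.
  by rewrite IH cat_rcons addrA.
pose I p t := a p <= t < a p + w p.
have shift p e t : I (rcons p e) t =
    (c p e <= t - a p < c p e + w (rcons p e)).
  by rewrite /I /a auxE /= lerBrDl ltrBlDl addrA.
have shift0 p t : I p t = (0 <= t - a p < w p).
  by rewrite /I subr_ge0 ltrBlDl.
have I_nil t : I [::] t = (0 <= t < 1) by rewrite /I /a /= w_nil add0r.
have I_rcons p t : I p t <-> exists e, I (rcons p e) t.
  rewrite shift0 (cP p).1; split => -[e h]; exists e; first by rewrite shift.
  by rewrite -shift.
have I_uniq p t e e' : I (rcons p e) t -> I (rcons p e') t -> e = e'.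
  by rewrite !shift; exact: (cP p).2.
have /choice[nxt nxtP] : forall tp : R * seq T, exists e, I tp.2 tp.1 ->
    I (rcons tp.2 e) tp.1.
  move=> [t p] /=; have [/I_rcons[e]|nI] := pselect (I p t); first by exists e.
  by exists e0.
(* [pr t n] is the word of length [n] whose interval contains [t]; the default [e0] in [nxt] is
   reached only for [t] outside [[0, 1[]. *)
pose fix pr t n := if n is k.+1 then rcons (pr t k) (nxt (t, pr t k)) else [::].
exists a, (fun t n => nxt (t, pr t n)).
have Ip t p : I p t -> 0 <= t < 1.
  elim/last_ind: p => [|p e IH]; first by rewrite I_nil.
  by move=> h; apply: IH; apply/I_rcons; exists e.
split; first exact: Ip.
move=> t p t01.
have prE n : mkseq (fun n => nxt (t, pr t n)) n = pr t n.
  by elim: n => [//|n IH]; rewrite mkseqS IH.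
have prI n : I (pr t n) t.
  by elim: n => [|n IH]; [rewrite /= I_nil|exact: (nxtP (t, pr t n))].
rewrite prE -/(I p t); split => [<-//|].
elim/last_ind: p => [//|p e IH] h.
have /IH pE : I p t by apply/I_rcons; exists e.
rewrite size_rcons /= pE; congr rcons; apply: (I_uniq p t) h.
by have := prI (size p).+1; rewrite /= pE.
Qed.

End IntervalTree.

Lemma countable_seqs (T : choiceType) (S : set T) : countable S ->
  countable [set p : seq T | forall e, e \in p -> S e].
Proof.
move=> /countable_injP[g ginj].
apply/countable_injP; exists (fun p => choice.pickle (map g p)) => p q.
rewrite !inE => /= pS qS /(pcan_inj choice.pickleK).
elim: p q pS qS => [|e p IH] [|f q] //= pS qS [ef pq]; congr (_ :: _).
  by apply: ginj; rewrite ?inE//; [apply: pS|apply: qS]; rewrite mem_head.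
apply: IH pq => x xp; [apply: pS|apply: qS]; by rewrite in_cons xp orbT.
Qed.

(** * Measurability of path-valued maps *)

Section PathValued.
Context {R : realType} {E : digraph} (Rg : set (vert E)) (x0 : boundary Rg).
Context (S : set (edge E)).
Hypothesis S_count : countable S.
Local Open Scope ereal_scope.

(** A nonempty edge list determines its source. The empty list stands for the whole space, as the
    root of the interval tree, rather than for a vertex. *)
Definition ecyl (p : seq (edge E)) : set (boundary Rg) :=
  if p is e :: _ then bcyl (src e) p else setT.

(* The infinite paths with all edges in the countable set [S] form a second
   countable subspace, although the boundary need not be second countable. *)
Definition path_valued (D : set (measurableTypeR R)) (h : R -> boundary Rg) :=
  [/\ measurable D, forall t, D t -> infinite (h t),
    forall t n e, D t -> e \in pre (set_val (h t)) n -> S e &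
    forall p, measurable (D `&` h @^-1` ecyl p : set (measurableTypeR R))].

(** Minimality makes these cylinders disjoint, and words over [S] are countably many. Uncountably
    many cylinders may be needed to cover [U] itself, but these suffice for the values of a
    path-valued map. *)
Definition minimal_cyls (U : set (boundary Rg)) : set (seq (edge E)) :=
  [set p | [/\ p <> [::], forall e, e \in p -> S e, ecyl p `<=` U &
    forall n, (0 < n < size p)%N -> ~ ecyl (take n p) `<=` U]].

Lemma countable_minimal_cyls U : countable (minimal_cyls U).
Proof.
apply: sub_countable (countable_seqs S_count).
by apply: subset_card_le => p [].
Qed.

Lemma ecyl_eq (x : boundary Rg) p q : p <> [::] -> ecyl p x -> ecyl q x ->
  (size p <= size q)%N -> p = take (size p) q.
Proof.
case: p => [//|e p] _; case: q => [//|f q] ex fx pq.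
by have [] := cyl_comparable ex fx pq.
Qed.

Lemma minimal_cyls_cover D h U : path_valued D h -> open U ->
  D `&` h @^-1` U = \bigcup_(p in minimal_cyls U) (D `&` h @^-1` ecyl p).
Proof.
move=> [_ hinf hS _] oU; apply/seteqP; split => t; last first.
  by move=> [p [_ _ pU _] [Dt /pU]].
move=> [Dt Ut]; have it := hinf _ Dt.
pose x := set_val (h t); pose P n := `[< (0 < n)%N /\ ecyl (pre x n) `<=` U >].
have preE n : (0 < n)%N -> exists e q, pre x n = e :: q /\ src e = psource x.
  case: n => // n _; have := it n.+1; have := pre_walk x n.+1.
  by rewrite -/x; case: (pre x n.+1) => [//|e q] /= /andP[/eqP ex _] _; exists e, q.
have xpre n : ecyl (pre x n) (h t).
  case: n => [|n]; first by rewrite /ecyl; case: (x) => [u|y] //=; rewrite take0.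
  have [//|e [q [xq ex]]] := preE n.+1.
  by rewrite xq /ecyl ex -xq; exact: cyl_pre.
have [n Pn] : exists n, P n.
  have [n hn] := open_infinite_bcyl oU Ut it.
  exists n.+1; apply/asboolP; split => // z.
  have [//|e [q [xq ex]]] := preE n.+1.
  rewrite xq /ecyl ex -xq => hz; apply: hn.
  have := cyl_take n hz; rewrite pre_pre//.
have [k /asboolP [k0 kU] kmin] := ex_minnP (ex_intro P n Pn).
exists (pre x k); last by split => //; exact: xpre.
split => //.
- by have [e [q [-> _]]] := preE k k0.
- by move=> e; exact: hS.
- move=> j /andP[j0 jk] jU.
  have jk' : (j < k)%N by rewrite -(it k).
  have := kmin j; rewrite leqNgt jk' => /(_ _)/notF; apply.
  by apply/asboolP; split => //; rewrite -(pre_pre x (ltnW jk')).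
Qed.

Lemma trivIset_minimal_cyls D (h : R -> boundary Rg) U :
  trivIset (minimal_cyls U) (fun p => D `&` h @^-1` ecyl p).
Proof.
suff le p q t : minimal_cyls U p -> minimal_cyls U q -> ecyl p (h t) ->
    ecyl q (h t) -> (size p <= size q)%N -> p = q.
  move=> p q pU qU [t [[_ pt] [_ qt]]].
  have [pq|/ltnW pq] := leqP (size p) (size q); first exact: (le p q t).
  by apply/esym; exact: (le q p t).
move=> [p0 _ pU _] [_ _ _ qmin] pt qt.
rewrite leq_eqVlt => /orP[/eqP pq|pq].
  by rewrite (ecyl_eq p0 pt qt) ?pq// take_size.
exfalso; apply: (qmin (size p)); first by rewrite pq andbT; case: (p) p0.
by rewrite -(ecyl_eq p0 pt qt)// ltnW.
Qed.

(** Borel sets are generated by open sets, and the preimage of an open set is a countable disjoint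
    union of preimages of cylinders. *)
Lemma measurable_path_valued D h : path_valued D h ->
  measurable_fun D (h : measurableTypeR R -> borel x0).
Proof.
move=> pv; apply: (@measurability _ _ (measurableTypeR R) (borel x0) D h
  (borel_open (boundary Rg) x0)) => //.
move=> _ [U oU <-]; rewrite (minimal_cyls_cover pv oU).
have [_ _ _ mh] := pv.
by have [] := measure_countable_bigcup (lebesgue_measure (R := R))
  (countable_minimal_cyls U) (fun p _ => mh p) (@trivIset_minimal_cyls D h U).
Qed.

Lemma path_valued_open D h U : path_valued D h -> open U ->
  lebesgue_measure (D `&` h @^-1` U) =
  \esum_(p in minimal_cyls U) lebesgue_measure (D `&` h @^-1` ecyl p).
Proof.
move=> pv oU; rewrite (minimal_cyls_cover pv oU).
have [_ _ _ mh] := pv.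
by have [] := measure_countable_bigcup (lebesgue_measure (R := R))
  (countable_minimal_cyls U) (fun p _ => mh p) (@trivIset_minimal_cyls D h U).
Qed.

(** The minimal cylinders of [U] depend on [U] and [S] but not on the map, so proportionality on
    cylinders extends to open sets. These are stable under intersection, and Dynkin induction
    reaches all Borel sets. *)
Lemma path_valued_unique D1 h1 D2 h2 (k : R) :
  path_valued D1 h1 -> path_valued D2 h2 -> (0 <= k)%R ->
  lebesgue_measure D1 < +oo -> lebesgue_measure D2 < +oo ->
  (forall p, lebesgue_measure (D1 `&` h1 @^-1` ecyl p) =
    k%:E * lebesgue_measure (D2 `&` h2 @^-1` ecyl p)) ->
  forall A : set (borel x0), measurable A ->
    lebesgue_measure (D1 `&` h1 @^-1` A) =
    k%:E * lebesgue_measure (D2 `&` h2 @^-1` A).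
Proof.
move=> pv1 pv2 k0 fin1 fin2 pE.
have DE : lebesgue_measure D1 = k%:E * lebesgue_measure D2.
  by have := pE [::]; rewrite /= !preimage_setT !setIT.
have [mD1 _ _ _] := pv1; have [mD2 _ _ _] := pv2.
have m1 := measurable_path_valued pv1 mD1.
have m2 := measurable_path_valued pv2 mD2.
apply: (@dynkin_induction _ (borel x0) (borel_open (boundary Rg) x0)
  (fun A => lebesgue_measure (D1 `&` h1 @^-1` A) =
    k%:E * lebesgue_measure (D2 `&` h2 @^-1` A))) => //.
- by move=> A B; exact: openI.
- by rewrite !preimage_setT !setIT.
- move=> U oU; rewrite !path_valued_open// -esumZl//.
  by apply: eq_esum => p _; exact: pE.
- move=> A mA AE.
  have DI (D : set R) (h : R -> boundary Rg) :
      D `&` h @^-1` (~` A) = D `\` (D `&` h @^-1` A).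
    apply/seteqP; split => t [Dt nA]; split => //; first by move=> [].
    by move=> At; apply: nA.
  have DID (D : set R) (h : R -> boundary Rg) :
      D `&` (D `&` h @^-1` A) = D `&` h @^-1` A by rewrite setIA setIid.
  have E1 : lebesgue_measure (D1 `\` (D1 `&` h1 @^-1` A)) =
      lebesgue_measure D1 - lebesgue_measure (D1 `&` h1 @^-1` A).
    by rewrite (measureD mD1 (m1 _ mA) fin1) (DID D1 h1).
  have E2 : lebesgue_measure (D2 `\` (D2 `&` h2 @^-1` A)) =
      lebesgue_measure D2 - lebesgue_measure (D2 `&` h2 @^-1` A).
    by rewrite (measureD mD2 (m2 _ mA) fin2) (DID D2 h2).
  rewrite (DI D1 h1) (DI D2 h2) E1 E2.
  rewrite AE DE muleBr//.
  rewrite fin_num_adde_defr// ge0_fin_numE ?measure_ge0//.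
- move=> F mF tF FE; rewrite !preimage_bigcup !setI_bigcupr.
  have tr D (h : R -> boundary Rg) : trivIset setT (fun i => D `&` h @^-1` F i).
    by move=> i j _ _ [t [[_ it] [_ jt]]]; apply: tF => //; exists (h t).
  rewrite !measure_bigcup//; last 2 first.
  + by move=> i _; exact: m2.
  + by move=> i _; exact: m1.
  rewrite -nneseriesZl//.
  by apply: eq_eseriesr => i _; exact: FE.
Qed.

End PathValued.

(** * Image of Lebesgue measure as a probability *)

Section Law.
Context {R : realType} d (T : measurableType d).
Context (D : set (measurableTypeR R)) (h : measurableTypeR R -> T).
Local Open Scope ereal_scope.

Definition law of measurable D & measurable_fun D h & lebesgue_measure D = 1 :=
  fun A : set T => lebesgue_measure (D `&` h @^-1` A).

Hypotheses (mD : measurable D) (mh : measurable_fun D h).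
Hypothesis D1 : lebesgue_measure D = 1.

Let law0 : law mD mh D1 set0 = 0.
Proof. by rewrite /law preimage_set0 setI0 measure0. Qed.

Let law_ge0 A : 0 <= law mD mh D1 A.
Proof. exact: measure_ge0. Qed.

Let law_sigma_additive : semi_sigma_additive (law mD mh D1).
Proof.
move=> F mF tF mUF; rewrite /law preimage_bigcup setI_bigcupr.
apply: measure_semi_sigma_additive.
- by move=> n; exact: mh.
- by move=> i j _ _ [t [[_ it] [_ jt]]]; apply: tF => //; exists (h t).
- by apply: bigcupT_measurable => n; exact: mh.
Qed.

HB.instance Definition _ := isMeasure.Build _ _ _ (law mD mh D1)
  law0 law_ge0 law_sigma_additive.

Let law_setT : law mD mh D1 setT = 1.
Proof. by rewrite /law preimage_setT setIT. Qed.

HB.instance Definition _ :=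
  Measure_isProbability.Build _ _ _ (law mD mh D1) law_setT.

End Law.

(** * Coding infinite paths by points of the unit interval *)

Section Coding.
Context {R : realType} {E : digraph} (Rg : set (vert E)).
Context (N : edge E -> R) (beta : R) (m : vert E -> R).
Hypothesis N_gt0 : forall e, 0 < N e.
Hypothesis m_ge0 : forall v, 0 <= m v.
Hypothesis m_sum : (\esum_(v in [set: vert E]) (m v)%:E = 1)%E.
Hypothesis m_harm : forall v,
  (\esum_(e in out_edges v) (N e `^ (- beta) * m (tgt e))%:E = (m v)%:E)%E.

Let K e := N e `^ (- beta).

Let K_gt0 e : 0 < K e. Proof. exact: powR_gt0. Qed.

(** The measure that [ecyl p] is to receive: the total mass for the empty list, and 0 for lists that
    are not walks, so that all words over the edges form one tree. *)
Definition path_mass (p : seq (edge E)) : R :=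
  if p is e :: _ then
    if walk (src e) p then wt (fun e => N e `^ (- beta)) p * m (pend (src e) p)
    else 0
  else 1.

Definition charged_edges : set (edge E) := [set e | 0 < m (tgt e)].

Lemma path_mass_ge0 p : 0 <= path_mass p.
Proof.
case: p => [|e p] //; rewrite /path_mass; case: ifP => // _.
by rewrite mulr_ge0// wt_ge0.
Qed.

Lemma esum_edges : (\esum_(e in [set: edge E]) (K e * m (tgt e))%:E = 1)%E.
Proof.
rewrite -m_sum (eq_esum (fun v _ => esym (m_harm v))).
rewrite esum_esum; last by move=> v e _ _; rewrite lee_fin mulr_ge0 ?(ltW (K_gt0 e)).
rewrite (reindex_esum (setT `*`` (@out_edges E)) _ snd)//.
split => [[]//|[v e] [w f]|e _]; last by exists (src e, e).
by rewrite !inE /= => -[_ <-] [_ <-] ->.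
Qed.

Lemma countable_charged_edges : countable charged_edges.
Proof.
apply: sub_countable (countable_esum (A := setT)
  (a := fun e => (K e * m (tgt e))%:E) _ _).
- by apply: subset_card_le => e Se; split => //; rewrite lte_fin mulr_gt0.
- by move=> e; rewrite lee_fin mulr_ge0// ltW.
- by rewrite esum_edges ltry.
Qed.

(** Below the root this is harmonicity at the end of the walk; at the root it is harmonicity summed
    over all vertices. *)
Lemma path_mass_rcons p :
  (\esum_(e in [set: edge E]) (path_mass (rcons p e))%:E = (path_mass p)%:E)%E.
Proof.
case: p => [|f p].
  rewrite -esum_edges; apply: eq_esum => e _.
  by rewrite /path_mass /= eqxx /wt big_seq1.
set v := src f; set q := f :: p.
have massE r : path_mass (f :: r) =
  if walk v (f :: r) then wt K (f :: r) * m (pend v (f :: r)) else 0 by [].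
rewrite (eq_esum (fun e _ => congr1 EFin (massE (rcons p e)))) massE -/q.
rewrite (_ : (\esum_(e in _) _)%E = (\esum_(e in [set: edge E])
  (if walk v (rcons q e) then wt K (rcons q e) * m (pend v (rcons q e))
   else 0)%:E)%E); last by apply: eq_esum.
case: ifP => vq; last first.
  apply: esum1 => e _; case: ifP => //.
  by rewrite -cats1 walk_cat vq.
rewrite EFinM -m_harm -esumZl ?wt_ge0//; last first.
  by move=> e; rewrite lee_fin mulr_ge0 ?powR_ge0.
rewrite [RHS]esum_mkcond; apply: eq_esum => e _.
rewrite -cats1 walk_cat vq pend_cat wt_cat /= andbT -EFinM.
case: ifP => [/eqP se|/eqP se]; last first.
  by rewrite memNset.
by rewrite mem_set// /wt big_seq1 mulrA.
Qed.

(** Masses do not increase under extension, so every prefix of [p] has positive mass, and its last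
    edge is then charged. *)
Lemma path_mass_charged p : 0 < path_mass p ->
  forall e, e \in p -> charged_edges e.
Proof.
have charged_last q f : 0 < path_mass (rcons q f) -> charged_edges f.
  have [v ->] : exists v, path_mass (rcons q f) =
      if walk v (rcons q f) then wt K (rcons q f) * m (tgt f) else 0.
    have pendE v : pend v (rcons q f) = tgt f by rewrite /pend map_rcons last_rcons.
    by case: q pendE => [|f' q] pendE;
      [exists (src f)|exists (src f')]; rewrite -(pendE (src f)).
  case: ifP => _; last by rewrite ltxx.
  by rewrite pmulr_rgt0// wt_gt0.
elim/last_ind: p => [//|p e IH] wp f.
rewrite mem_rcons in_cons => /orP[/eqP ->|fp]; first exact: charged_last wp.
apply: IH fp; apply: lt_le_trans wp _.
rewrite -lee_fin -(path_mass_rcons p).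
apply: (@esum_ge1 _ _ _ (fun e => (path_mass (rcons p e))%:E)) => // e'.
by rewrite lee_fin path_mass_ge0.
Qed.

Lemma path_coding : exists (a : seq (edge E) -> R) (f : R -> boundary Rg),
  [/\ forall t p, a p <= t < a p + path_mass p -> 0 <= t < 1,
    forall t, 0 <= t < 1 -> infinite (f t) &
    forall t p, p <> [::] -> 0 <= t < 1 ->
      (ecyl p (f t) <-> a p <= t < a p + path_mass p)].
Proof.
have [e0 _] : exists e : edge E, True.
  apply: contrapT => h; have := esum_edges; rewrite esum1.
    by move=> /esym/eqP; rewrite onee_eq0.
  by move=> e _; exfalso; apply: h; exists e.
have charged_last p e : 0 < path_mass (rcons p e) -> charged_edges e.
  by move=> /path_mass_charged; apply; rewrite mem_rcons mem_head.
have [a [g [aI gI]]] := interval_tree e0 countable_charged_edges path_mass_ge0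
  erefl charged_last path_mass_rcons.
(* A point lies in the interval of each of its prefixes; these intervals are nonempty, so the
   prefixes have positive mass and hence are walks. *)
have gwalk t n : 0 <= t < 1 -> walk (src (g t 0%N)) (mkseq (g t) n.+1).
  move=> t01; have := gI t (mkseq (g t) n.+1) t01.
  rewrite size_mkseq => -[/(_ erefl) /andP[h1 h2] _].
  have : 0 < path_mass (mkseq (g t) n.+1).
    by rewrite -(ltrD2l (a (mkseq (g t) n.+1))) addr0 (le_lt_trans h1).
  by rewrite /path_mass /=; case: ifP => //; rewrite ltxx.
have gcomp t n : 0 <= t < 1 -> tgt (g t n) = src (g t n.+1).
  move=> /(gwalk t n.+1); rewrite -(addn2 n) /mkseq iotaD map_cat walk_cat.
  rewrite add0n /= => /andP[_ /andP[_ /andP[/eqP ->]]] //.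
have path_of t : 0 <= t < 1 ->
    exists x : boundary Rg, exists2 y, set_val x = Inf y & sval y = g t.
  move=> t01; pose y : infpath E :=
    exist (fun x => forall n, tgt (x n) = src (x n.+1)) (g t)
      (fun n => gcomp t n t01).
  have By : boundary Rg (Inf y) by left; exists y.
  by exists (exist _ (Inf y) (mem_set By)); exists y.
have [|x0 _] := path_of 0; first by rewrite lexx ltr01.
have /choice[f fP] : forall t, exists x : boundary Rg, 0 <= t < 1 ->
    exists2 y, set_val x = Inf y & sval y = g t.
  move=> t; have [/path_of[x xP]|nt] := pselect (0 <= t < 1); last by exists x0.
  by exists x.
exists a, f; split => // [t /fP[y fy _]|t p p0 t01].
  by apply/infiniteP; exists y.
rewrite -gI//; have [y fy yg] := fP t t01.
case: p p0 => [//|e p] _; rewrite /ecyl /bcyl /cyl /= fy /= yg.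
by split => [[_ ->]//|gp]; split => //; case: gp => ->.
Qed.

End Coding.

(** * The law of the coded path as associated measure *)

Section PathLaw.
Context {R : realType} {E : digraph} (Rg : set (vert E)).
Context (N : edge E -> R) (beta : R) (m : vert E -> R).
Hypothesis N_gt0 : forall e, (0 < N e)%R.
Hypothesis m_ge0 : forall v, (0 <= m v)%R.
Hypothesis m_sum : (\esum_(v in [set: vert E]) (m v)%:E = 1)%E.
Hypothesis m_harm : forall v,
  (\esum_(e in out_edges v) (N e `^ (- beta) * m (tgt e))%:E = (m v)%:E)%E.
Local Open Scope ereal_scope.

Let K e := (N e `^ (- beta))%R.
Let K_gt0 e : (0 < K e)%R. Proof. exact: powR_gt0. Qed.
Let S := charged_edges m.
Let w := path_mass N beta m.
Let lam := @lebesgue_measure R.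

Context (a : seq (edge E) -> R) (f : R -> boundary Rg).
Hypothesis a01 : forall t p, (a p <= t < a p + w p)%R -> (0 <= t < 1)%R.
Hypothesis f_inf : forall t, (0 <= t < 1)%R -> infinite (f t).
Hypothesis f_cyl : forall t p, p <> [::] -> (0 <= t < 1)%R ->
  (ecyl p (f t) <-> (a p <= t < a p + w p)%R).

Let D : set (measurableTypeR R) := [set t | (0 <= t < 1)%R].
Let I p : set (measurableTypeR R) := [set t | (a p <= t < a p + w p)%R].

Let ItvE (x y : R) : [set t | (x <= t < y)%R] = `[x, y[%classic.
Proof. by apply/seteqP; split => t /=; rewrite in_itv. Qed.

Let mD : measurable D. Proof. by rewrite /D ItvE. Qed.

Let mI p : measurable (I p). Proof. by rewrite /I ItvE. Qed.

Let lamD : lam D = 1.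
Proof. by rewrite /lam /D ItvE lebesgue_measure_itv/= lte_fin ltr01 oppr0 adde0. Qed.

Let lamI p : lam (I p) = (w p)%:E.
Proof.
rewrite /lam /I ItvE lebesgue_measure_itv/= lte_fin ltrDl.
have [w0|] := ltP 0%R (w p); first by rewrite -EFinB addrAC subrr add0r.
move=> h; congr EFin; apply/eqP; rewrite eq_le h andbT.
by apply: path_mass_ge0.
Qed.

Let DI p : p <> [::] -> D `&` f @^-1` ecyl p = I p.
Proof.
move=> p0; apply/seteqP; split => t; first by move=> [Dt /(f_cyl p0 Dt)].
by move=> It; have Dt := a01 It; split => //; apply/(f_cyl p0 Dt).
Qed.

Let f_charged t n e : D t -> e \in pre (set_val (f t)) n -> S e.
Proof.
move=> Dt ep; have it := f_inf Dt.
have p0 : pre (set_val (f t)) n <> [::] by move=> p0; rewrite p0 in ep.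
have : ecyl (pre (set_val (f t)) n) (f t).
  have := pre_walk (set_val (f t)) n; have := cyl_pre (set_val (f t)) n.
  by case: (pre _ n) p0 => [//|e' q] _ hc /= /andP[/eqP -> _].
move=> /(f_cyl p0 Dt) /andP[h1 h2].
apply: (path_mass_charged N_gt0 m_ge0 m_sum m_harm) ep.
by rewrite -(ltrD2l (a (pre (set_val (f t)) n))) addr0 (le_lt_trans h1).
Qed.

Let pvf : path_valued S D f.
Proof.
split => // p.
by case: p => [|e p]; [rewrite preimage_setT setIT|rewrite DI].
Qed.

Let x0 := f 0.

Let cS : countable S.
Proof. exact: countable_charged_edges. Qed.

Let mf : measurable_fun D (f : measurableTypeR R -> borel x0).
Proof. exact: measurable_path_valued cS _ _ pvf. Qed.

Let mu : probability (borel x0) R := law mD mf lamD.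

Let muE (A : set (boundary Rg)) : mu A = lam (D `&` f @^-1` A).
Proof. by []. Qed.

(** All coded paths are infinite, so those starting at [v] split according to their first edge,
    which is charged. Harmonicity sums up the lengths of these intervals, uncharged edges adding
    0. *)
Let mu_vertex v : mu (bcyl v [::]) = (m v)%:E.
Proof.
rewrite muE.
have -> : D `&` f @^-1` bcyl v [::] =
    \bigcup_(e in out_edges v `&` S) I [:: e].
  apply/seteqP; split => t.
    move=> [Dt [xv _]]; have it := f_inf Dt.
    have := cyl_pre (set_val (f t)) 1; have := pre_walk (set_val (f t)) 1.
    have := it 1%N; case xE : (pre _ 1) => [//|e []]// _ /= /andP[/eqP se _] ce.
    have Se : S e by apply: (f_charged (n := 1) Dt); rewrite xE mem_head.
    exists e; first by split => //; rewrite /out_edges /= se.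
    by rewrite -DI//; split => //; rewrite /= /bcyl /= se.
  move=> [e [ev _]]; rewrite -DI// => -[Dt [se _]]; split => //.
  by split; [rewrite se|case: (set_val _) => [u|y] //=; rewrite take0].
have tI : trivIset (out_edges v `&` S) (fun e => I [:: e]).
  move=> e e' [ev _] [ev' _] [t []]; rewrite -!DI// => -[_ [_ p1]] [_ [_ p2]].
  by have [] : [:: e] = [:: e'] := etrans (esym p1) p2.
have cvS : countable (out_edges v `&` S).
  by apply: sub_countable cS; apply: subset_card_le; exact: subIsetr.
have -> : lam (\bigcup_(e in out_edges v `&` S) I [:: e]) =
    \esum_(e in out_edges v `&` S) lam (I [:: e]).
  have [_ h] := measure_countable_bigcup (lebesgue_measure (R := R)) cvS
    (fun e _ => mI [:: e]) tI.
  exact: h.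
rewrite -m_harm esum_mkcondr; apply: eq_esum => e ev.
have we : w [:: e] = (N e `^ (- beta) * m (tgt e))%R.
  by rewrite /w /path_mass /= eqxx /wt big_seq1.
rewrite lamI we; case: ifPn => //; rewrite notin_setE => nS.
congr EFin; have : m (tgt e) = 0%R; last by move=> ->; rewrite mulr0.
by apply/eqP; rewrite eq_le m_ge0 andbT leNgt; apply/negP.
Qed.

(* Off the countably many left endpoints [a p], the map [f] is continuous, so
   inner regularity of Lebesgue measure is transported to its law. *)
Let mu_regular : regular_measure mu.
Proof.
apply: inner_regular_regular; first exact: hausdorff_boundary.
move=> A e mA e0.
pose ends : set (measurableTypeR R) :=
  a @` [set p : seq (edge E) | forall e', e' \in p -> S e'].
have cends : countable ends.
  by apply: sub_countable (countable_seqs cS); exact: card_image_le.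
have mends : measurable ends by apply: countable_measurable => // t; exact: measurable_set1.
have ends0 : lam ends = 0 by exact: countable_lebesgue_measure0.
pose B : set (measurableTypeR R) := (D `&` f @^-1` A) `\` ends.
have mB : measurable B by apply: measurableD => //; exact: mf.
have muB : mu A = lam B.
  rewrite muE /B; apply/eqP; rewrite eq_le; apply/andP; split; last first.
    apply: le_measure; rewrite ?inE//; first exact: mf.
  apply: (@le_trans _ _ (lam (B `|` ends))).
    apply: le_measure; rewrite ?inE; [exact: mf|exact: measurableU|].
    by move=> t At; have [et|net] := pselect (ends t); [right|left].
  by apply: le_trans (measureU2 _ _ _) _ => //; rewrite [X in _ + X]ends0 adde0.
have Boo : lam B < +oo by rewrite -muB (le_lt_trans (probability_le1 _ _))// ltry.
have [L [cL LB muL]] := lebesgue_regularity_inner mB Boo e0.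
have cont t : L t -> {for t, continuous f}.
  move=> /LB [[Dt _] nt] U; rewrite /= nbhsE => -[V [oV Vt] VU].
  have it := f_inf Dt.
  have [n hn] := open_infinite_bcyl oV Vt it.
  pose p := pre (set_val (f t)) n.+1.
  have p0 : p <> [::] by move=> /(congr1 size); rewrite /p it.
  have ptE (z : boundary Rg) : ecyl p z <-> bcyl (psource (set_val (f t))) p z.
    have := pre_walk (set_val (f t)) n.+1; rewrite -/p.
    by case: (p) p0 => [//|e' q] _ /= /andP[/eqP -> _].
  have /(f_cyl p0 Dt) /andP[ap tp] : ecyl p (f t) by apply/ptE; exact: cyl_pre.
  have {}ap : (a p < t)%R.
    rewrite lt_neqAle ap andbT; apply/eqP => at_; apply: nt; exists p => // e'.
    exact: f_charged.
  have : \forall s \near t, (a p < s < a p + w p)%R.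
    near=> s; apply/andP; split; near: s; [exact: lt_nbhsr|exact: lt_nbhsl].
  apply: filterS => s /andP[h1 h2]; apply: VU; apply: hn.
  have Is : (a p <= s < a p + w p)%R by rewrite (ltW h1).
  have /ptE := (f_cyl p0 (a01 Is)).2 Is.
  by move=> hs; have := cyl_take n hs; rewrite pre_pre.
exists (f @` L); split.
- apply: continuous_compact cL; apply: continuous_in_subspaceT => t.
  by rewrite inE; exact: cont.
- by move=> _ [t /LB [[_ At] _] <-].
- rewrite muB; apply: (@le_trans _ _ (lam L + lam (B `\` L))).
    rewrite -{1}(setDUK LB); apply: measureU2.
      exact: measurable_realfun.compact_measurable.
    by apply: measurableD => //; exact: measurable_realfun.compact_measurable.
  apply: leeD; last exact: ltW.
  rewrite muE; apply: le_outer_measure => t Lt.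
  by have [[Dt _] _] := LB _ Lt; split => //; exists t.
Unshelve. all: by end_near.
Qed.

(** On the interval of [[:: e]] let [h] be the coded path without its first edge. Its law and that
    of [f] on paths starting at [tgt e] are proportional on cylinders with factor [K e], hence on
    all Borel sets. *)
Let mu_scale e (A : set (boundary Rg)) : measurable (A : set (borel x0)) ->
  A `<=` bcyl (tgt e) [::] ->
  mu [set y | exists2 x, A x & econs e (set_val x) (set_val y)] = (K e)%:E * mu A.
Proof.
move=> mA Ae.
have /choice[h hP] : forall t, exists x : boundary Rg, I [:: e] t ->
    bcyl (tgt e) [::] x /\ econs e (set_val x) (set_val (f t)).
  move=> t; have [It|nI] := pselect (I [:: e] t); last by exists x0.
  have : bcyl (src e) [:: e] (f t) by move: It; rewrite -DI// => -[].
  by rewrite -econs_bcyl => -[x xe ex]; exists x.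
have hpre t : I [:: e] t -> psource (set_val (h t)) = tgt e /\
    forall n, pre (set_val (f t)) n.+1 = e :: pre (set_val (h t)) n.
  by move=> /hP [_ /econs_pre []].
pose D2 := D `&` f @^-1` bcyl (tgt e) [::].
have mD2 : measurable D2 by apply: mf => //; exact: measurable_bcyl.
have hcyl e' q : I [:: e] `&` h @^-1` ecyl (e' :: q) =
    if src e' == tgt e then I [:: e, e' & q] else set0.
  case: eqP => [se|se]; last first.
    apply/seteqP; split => // t [/hpre [ht _]] [hs _].
    by apply: se; rewrite -hs ht.
  rewrite -!DI//; apply/seteqP; split => t [].
    rewrite DI// => It [_ hq]; have [Dt fe] : (D `&` f @^-1` ecyl [:: e]) t by rewrite DI.
    by split => //; split; [case: fe|rewrite /= (hpre t It).2 hq].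
  move=> Dt [fs fq]; have It : (D `&` f @^-1` ecyl [:: e]) t.
    by split => //; split => //; rewrite -(pre_pre _ (leq_addr (size q).+1 1)) fq.
  split => //; rewrite DI// in It; have [ht hn] := hpre _ It.
  by split; [rewrite ht|move: fq; rewrite /= hn => -[]].
have pv1 : path_valued S (I [:: e]) h.
  split => // [t It n|t n e' It en|[|e' q]].
  - have Dt : D t by exact: a01 It.
    by have := f_inf Dt n.+1; rewrite (hpre t It).2 /= => -[].
  - apply: (f_charged (n := n.+1) (a01 It)).
    by rewrite (hpre t It).2 in_cons en orbT.
  - by rewrite /= preimage_setT setIT.
  - by rewrite hcyl; case: eqP => _.
have pv2 : path_valued S D2 f.
  split => // [t [Dt _]|t n e' [Dt _]|p]; [exact: f_inf|exact: f_charged|].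
  rewrite (_ : D2 `&` _ = D2 `&` (D `&` f @^-1` ecyl p)).
    by apply: measurableI => //; case: pvf.
  by apply/seteqP; split => t [[Dt ?]]; [|move=> [_]].
have D2A (B : set (boundary Rg)) : B `<=` bcyl (tgt e) [::] ->
    D2 `&` f @^-1` B = D `&` f @^-1` B.
  move=> Be; apply/seteqP; split => t; first by move=> [[Dt _] Bt].
  by move=> [Dt Bt]; split => //; split => //; exact: Be.
have lamD2 : lam D2 = (m (tgt e))%:E by rewrite -mu_vertex muE.
have cyl_eq p : lam (I [:: e] `&` h @^-1` ecyl p) = (K e)%:E * lam (D2 `&` f @^-1` ecyl p).
  case: p => [|e' q].
    rewrite /= !preimage_setT !setIT lamI lamD2 -EFinM; congr EFin.
    by rewrite /w /path_mass /= eqxx /wt big_seq1.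
  rewrite hcyl; case: eqP => [se|se]; last first.
    have lam0 : lam set0 = 0 by exact: measure0.
    rewrite (_ : D2 `&` _ = set0) ?lam0 ?mule0//.
    apply/seteqP; split => // t [[_ [ft _]] [fs _]].
    by apply: se; rewrite -fs ft.
  rewrite D2A; last first.
    move=> x [xs _]; split; first by rewrite xs se.
    by case: (set_val x) => [u|y] //=; rewrite take0.
  rewrite DI// !lamI -EFinM; congr EFin.
  rewrite /w /path_mass; rewrite [walk _ (e :: _)]/= eqxx /= se eqxx /=.
  by case: ifP => _; rewrite ?mulr0// wt_cons mulrA.
have fin1 : lam (I [:: e]) < +oo by rewrite (lamI [:: e]) ltry.
have fin2 : lam D2 < +oo by rewrite lamD2 ltry.
have := path_valued_unique cS pv1 pv2 (ltW (K_gt0 e)) fin1 fin2 cyl_eq mA.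
rewrite (D2A A Ae) => /= scale.
rewrite [in RHS]muE; apply: etrans scale.
rewrite muE; congr lam; apply/seteqP; split => t.
  move=> [Dt [x Ax exy]]; have [xs fs fn] := econs_pre exy.
  have It : I [:: e] t.
    rewrite -DI//; split => //; split => //=.
    by rewrite fn; case: (set_val x) => [u|y] //=; rewrite take0.
  split => //; rewrite /preimage /=.
  (* Both paths arise from [f t] by removing [e], so they share source and prefixes, and cylinders
     separate points. *)
  suff -> : h t = x by [].
  have [hs hn] := hpre t It.
  have prE n : pre (set_val (h t)) n = pre (set_val x) n.
    by have := hn n; rewrite fn => -[].
  apply/val_inj; apply: contrapT => /(@pspace_separated _ _ _) [v [p]].
  by rewrite /cyl /= prE hs xs => -[[hh nh]|[hh nh]].
move=> [It At]; split; first exact: a01 It.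
by exists (h t) => //; have [] := hP t It.
Qed.

Lemma associated_measure_of_coding :
  exists (y0 : boundary Rg) (nu : probability (borel y0) R),
    associated_measure N beta m nu /\ nu (infinite (Rg := Rg)) = 1.
Proof.
exists x0, mu; split; last first.
  rewrite muE (_ : _ `&` _ = D) ?lamD//.
  by apply/seteqP; split => t [] // Dt; split => //; exact: f_inf.
split; first exact: mu_regular.
- by move=> v; rewrite -mu_vertex cylinderE.
- move=> e A mA Ae; apply: mu_scale => // x /Ae.
  by rewrite cylinderE.
Qed.

End PathLaw.

Lemma exists_associated_measure (R : realType) (E : digraph) (Rg : set (vert E))
    (N : edge E -> R) (beta : R) (m : vert E -> R) :
  (forall e, 0 < N e) -> (forall v, 0 <= m v) ->
  (\esum_(v in [set: vert E]) (m v)%:E = 1)%E ->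
  (forall v, \esum_(e in out_edges v) (N e `^ (- beta) * m (tgt e))%:E = (m v)%:E)%E ->
  exists (x0 : boundary Rg) (mu : probability (borel x0) R),
    associated_measure N beta m mu /\ (mu (infinite (Rg := Rg)) = 1)%E.
Proof.
move=> N0 m0 m1 mh; have [a [f [a01 f_inf f_cyl]]] := path_coding Rg N0 m0 m1 mh.
exact: (associated_measure_of_coding N0 m0 m1 mh a01 f_inf f_cyl).
Qed.

(** * Classification of the conservative functions *)

Section Dictionary.
Context {R : realType} {E : digraph} (N : edge E -> R) (beta : R).
Hypothesis N_gt0 : forall e, (0 < N e)%R.
Implicit Types (v w : vert E) (u : finpath E).
Local Open Scope ereal_scope.

Let K e := (N e `^ (- beta))%R.
Let K_gt0 e : (0 < K e)%R. Proof. exact: powR_gt0. Qed.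

Lemma pweightE u : (pweight N u `^ (- beta))%R = wt K (pedges u).
Proof.
rewrite /pweight /wt; elim: (pedges u) => [|e p IH].
  by rewrite !big_nil powR1.
rewrite !big_cons powRM ?IH// ?(ltW (N_gt0 _))//.
by apply: prodr_ge0 => i _; exact: ltW.
Qed.

Lemma pinitsegP (u u' : finpath E) : pinitseg u' (Fin u) <->
  psrc u' = psrc u /\
  exists2 n, (n < size (pedges u))%N & pedges u' = take n (pedges u).
Proof.
split => [[[us]]|[us [n nu up]]].
  rewrite prefixE => /eqP up nu; split=> //; exists (size (pedges u')) => //.
  rewrite ltnNge; apply/negP => le; apply: nu; congr Fin; apply/val_inj.
  rewrite [LHS]surjective_pairing [RHS]surjective_pairing; congr (_, _).
    exact: us.
  by rewrite take_oversize in up.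
split; first by split => //; rewrite up; exact: prefix_take.
by move=> [e]; move: up; rewrite e => /(congr1 size); rewrite size_take nu => ee;
  rewrite -ee ltnn in nu.
Qed.

Lemma finpath_walk u : walk (psrc u) (pedges u).
Proof. by case: u. Qed.

Lemma finpath_inj u u' : psrc u = psrc u' -> pedges u = pedges u' -> u = u'.
Proof.
move=> us up; apply/val_inj; rewrite [LHS]surjective_pairing.
by rewrite [RHS]surjective_pairing; congr (_, _).
Qed.

Lemma first_arrivalsE v u : first_arrivals v u <->
  walk_to (~` [set v]) [set v] (psrc u) (pedges u).
Proof.
rewrite walk_toP; split => [[uv h]|[wu uv h]].
  split => //; first exact: finpath_walk.
  move=> n nu; have [|u' [us up]] := @cyl_mk _ (psrc u) (take n (pedges u)).
    by have := finpath_walk u; rewrite -{1}(cat_take_drop n (pedges u)) walk_cat => /andP[].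
  have := h u'; rewrite /ptgt us up; apply.
  by apply/pinitsegP; split => //; exists n.
split => // u' /pinitsegP [us [n nu up]].
by rewrite /ptgt us up; exact: h.
Qed.

(** The intermediate segments have at least one edge, which is the edge that [first_returns] splits
    off; they correspond to the proper prefixes of the remainder. *)
Lemma simple_loopsE v u : simple_loops v u <->
  psrc u = v /\ first_returns v (pedges u).
Proof.
split => [[us uv u0 h]|[us]].
  split => //; case pE : (pedges u) => [|e p].
    by apply: u0; apply: finpath_inj => //; rewrite us.
  have := finpath_walk u; rewrite pE us /= => /andP[/eqP ev wp]; split => //.
  apply/walk_toP; split => // [|n np]; first by move: uv; rewrite /ptgt pE.
  have [|u' [us' up']] := @cyl_mk _ v (e :: take n p).
    by rewrite /= ev eqxx; move: wp; rewrite -{1}(cat_take_drop n p) walk_cat => /andP[].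
  have := h u'; rewrite /ptgt us' up'; apply.
    by apply/pinitsegP; split => //; exists 0%N; rewrite ?up'.
  by apply/pinitsegP; rewrite us us' pE; split => //; exists n.+1; rewrite ?up'.
case pE : (pedges u) => [//|e p] /= [ev /walk_toP [wp pv h]].
split => //; first by rewrite /ptgt pE.
  by move=> uv; rewrite uv in pE.
move=> u' /pinitsegP [us' [n nu' vn]] /pinitsegP [us2 [k]].
rewrite pE => ku up'; rewrite /ptgt up' us2.
case: k ku up' => [|k] ku up'; first by rewrite up' in nu'.
exact: h.
Qed.

Lemma hitE v w : \esum_(u in first_arrivals_from w v) (pweight N u `^ (- beta))%:E
  = hit K v w.
Proof.
rewrite /hit /walk_sum (reindex_esum (first_arrivals_from w v) _ (@pedges E)).
  by apply: eq_esum => u _; rewrite pweightE mule1.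
split.
- by move=> u [/first_arrivalsE uv <-].
- move=> u u'; rewrite !inE => -[_ us] [_ us'] pp.
  by apply: finpath_inj => //; rewrite us us'.
- move=> p [wp _]; have [u [us up]] := cyl_mk (walk_to_walk wp).
  by exists u => //; split => //; apply/first_arrivalsE; rewrite us up.
Qed.

Lemma totE v : Za N beta v = tot K v.
Proof.
rewrite /tot -esum_walk_sum// (reindex_esum (first_arrivals v) _ (fun u => (psrc u, pedges u))).
  by apply: eq_esum => u _; rewrite pweightE mule1.
split.
- by move=> u /first_arrivalsE.
- by move=> u u' _ _ [us up]; exact: finpath_inj.
- move=> [w p] [/= wp _]; have [u [us up]] := cyl_mk (walk_to_walk wp).
  by exists u; [apply/first_arrivalsE; rewrite us up|rewrite us up].
Qed.

Lemma zsE v : Zs N beta v = ret K v.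
Proof.
rewrite retE// (reindex_esum (simple_loops v) _ (@pedges E)).
  by apply: eq_esum => u _; rewrite pweightE.
split.
- by move=> u /simple_loopsE [].
- move=> u u'; rewrite !inE => /simple_loopsE [us _] /simple_loopsE [us' _] pp.
  by apply: finpath_inj => //; rewrite us us'.
- move=> p hp; have [wp _ _] := first_returns_walk hp.
  have [u [us up]] := cyl_mk wp.
  by exists u => //; apply/simple_loopsE; rewrite us up.
Qed.

Lemma crit_verticesE v : crit_vertices N beta v <-> crit K v.
Proof. by rewrite /crit_vertices /crit /= totE zsE. Qed.

Lemma mvertE v w : mvert N beta v w = (fine (hit K v w) * (fine (tot K v))^-1)%R.
Proof. by rewrite /mvert hitE totE. Qed.

Lemma connected_toE v w : connected_to v w <-> reach v w.
Proof.
split => [[u [<- <-]]|[p wp <-]]; first by exists (pedges u) => //; exact: finpath_walk.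
by have [u [us up]] := cyl_mk wp; exists u; rewrite /ptgt us up.
Qed.

End Dictionary.

(** * The bijection with the simplex *)

Section Classification.
Context {R : realType} {E : digraph} (Rg : set (vert E)).
Context (N : edge E -> R) (beta : R).
Hypothesis N_gt0 : forall e, (0 < N e)%R.
Local Open Scope ereal_scope.

Let K e := (N e `^ (- beta))%R.
Let K_gt0 e : (0 < K e)%R. Proof. exact: powR_gt0. Qed.

Let rep (c : crit_classes N beta) : vert E := class_repr c.

Let repP c : set_val c (rep c).
Proof. exact: (svalP (cid (crit_class_inhabited c))). Qed.

Lemma vequivE (v w : vert E) : vequiv v w <-> reach v w /\ reach w v.
Proof. by rewrite /vequiv !connected_toE. Qed.

Lemma classP (c : crit_classes N beta) v :
  set_val c v <-> crit K v /\ reach (class_repr c) v /\ reach v (class_repr c).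
Proof.
have := repP c; rewrite /rep; set r := class_repr _.
have [v0 cv0 <-] : crit_classes N beta (set_val c) by exact: set_valP.
move=> -[cr /vequivE [vr rv]].
split => [[/(crit_verticesE beta N_gt0) cv /vequivE [vv0 v0v]]|[cv [rw wr]]].
  by split => //; split; [exact: reach_trans rv vv0|exact: reach_trans v0v vr].
split; first exact/(crit_verticesE beta N_gt0).
by apply/vequivE; split; [exact: reach_trans vr rw|exact: reach_trans wr rv].
Qed.

Let crit_rep c : crit K (rep c).
Proof. by have [] := (classP c (rep c)).1 (repP c). Qed.

Let rep_onto v : crit K v -> exists c, reach (rep c) v.
Proof.
move=> /(crit_verticesE beta N_gt0) cv.
have hc : crit_classes N beta [set w | crit_vertices N beta w /\ vequiv v w] by exists v.
pose c : crit_classes N beta :=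
  exist (fun A => A \in crit_classes N beta) _ (mem_set hc).
have : set_val c v by split => //; exact: vequiv_refl.
by move=> /classP [_ [cv' _]]; exists c.
Qed.

Let rep_inj c d : reach (rep c) (rep d) -> reach (rep d) (rep c) -> c = d.
Proof.
move=> cd dc; apply/val_inj/seteqP; split => v /classP [cv [h1 h2]];
  apply/classP; split => //; split.
- exact: reach_trans dc h1.
- exact: reach_trans h2 cd.
- exact: reach_trans cd h1.
- exact: reach_trans h2 dc.
Qed.

Let h c v := fine (hit K (rep c) v).
Let z c := fine (tot K (rep c)).

Let hE c v : (h c v)%:E = hit K (rep c) v.
Proof.
rewrite fineK// ge0_fin_numE ?hit_ge0//; apply: hit_lty => //.
by have [] := crit_rep c.
Qed.

Let zE c : (z c)%:E = tot K (rep c).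
Proof.
have [zoo _] := crit_rep c.
by rewrite fineK// ge0_fin_numE// (le_trans _ (tot_ge1 K_gt0 _)).
Qed.

Let h_ge0 c v : (0 <= h c v)%R.
Proof. by rewrite -lee_fin hE hit_ge0. Qed.

Let z_ge1 c : (1 <= z c)%R.
Proof. by rewrite -lee_fin zE tot_ge1. Qed.

Let z_gt0 c : (0 < z c)%R. Proof. exact: lt_le_trans (z_ge1 c). Qed.

Let hz c v : (h c v <= z c)%R.
Proof. by rewrite -lee_fin hE zE hit_le_tot. Qed.

Let WinfE m c : Winf m c = (m (rep c) * z c)%R.
Proof. by rewrite /Winf totE. Qed.

Let mclassE c v : mclass c v = (h c v / z c)%R.
Proof. by rewrite /mclass mvertE. Qed.

Lemma Winf_class m (c : crit_classes N beta) v : Dbeta Rg N beta m ->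
  set_val c v -> (Winf m c)%:E = (m v)%:E * Za N beta v.
Proof.
move=> mD /classP [cv [rv _]]; rewrite totE// WinfE EFinM zE.
have fs := Dbeta_superharmonic mD.
by rewrite (crit_mass K_gt0 fs _ (crit_rep c) cv rv)// => x; rewrite ltry.
Qed.

Lemma Winf01 m (c : crit_classes N beta) : Dbeta Rg N beta m ->
  (0 <= Winf m c <= 1)%R.
Proof.
move=> mD; have [m01 m1 _ _] := mD; rewrite WinfE mulr_ge0 ?(ltW (z_gt0 c))//=.
  rewrite -lee_fin EFinM zE -m1.
  by apply: (mass_le K_gt0 (Dbeta_superharmonic mD)); rewrite ltry.
by have /andP[] := m01 (rep c).
Qed.

(** Passing to an equivalent critical vertex multiplies both [hit] and [tot] by the same nonzero
    number, which cancels in the quotient. *)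
Lemma mclass_class (c : crit_classes N beta) v : set_val c v ->
  mclass c = mvert N beta v.
Proof.
move=> /classP [cv [rv vr]]; apply/funext => x.
rewrite mclassE mvertE// -/K.
have cr := crit_rep c.
have hf : hit K v (rep c) \is a fin_num.
  by rewrite ge0_fin_numE ?hit_ge0// hit_lty//; case: cv.
rewrite (crit_hitM K_gt0 x cr cv rv) (crit_totM K_gt0 cr cv rv) -/(rep c).
rewrite -hE -zE -(fineK hf) -!EFinM /=.
have F0 : fine (hit K v (rep c)) != 0%R.
  apply/eqP => h0; have := crit_hit_inv K_gt0 cr cv rv.
  by rewrite -(fineK hf) h0 mul0e => /esym/eqP; rewrite onee_eq0.
by rewrite invfM mulrA mulfK.
Qed.

Let Winv (eps : crit_classes N beta -> R) v : R := fine (class_mixture eps v).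

Let c_ge0 (eps : crit_classes N beta -> R) c : class_simplex eps -> (0 <= eps c)%R.
Proof. by move=> [e01 _]; have /andP[] := e01 c. Qed.

Let mixtureE (eps : crit_classes N beta -> R) v : class_mixture eps v =
  \esum_(c in [set: crit_classes N beta]) ((eps c / z c)%:E * hit K (rep c) v).
Proof.
apply: eq_esum => c _; rewrite mclassE -hE -EFinM; congr EFin.
by rewrite mulrCA mulrC.
Qed.

Let ez_ge0 (eps : crit_classes N beta -> R) c : class_simplex eps ->
  (0 <= eps c / z c)%R.
Proof. by move=> es; rewrite mulr_ge0 ?c_ge0// invr_ge0 ltW. Qed.

Let mixture_le1 (eps : crit_classes N beta -> R) v : class_simplex eps ->
  class_mixture eps v <= 1.
Proof.
move=> es; have [_ e1] := es; rewrite -e1; apply: le_esum => c _.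
rewrite lee_fin ler_piMr ?c_ge0// mclassE ler_pdivrMr// mul1r; exact: hz.
Qed.

Let mixture_ge0 (eps : crit_classes N beta -> R) v : class_simplex eps ->
  0 <= class_mixture eps v.
Proof.
move=> es; apply: esum_ge0 => c _; rewrite lee_fin mulr_ge0 ?c_ge0//.
by rewrite mclassE mulr_ge0// invr_ge0 ltW.
Qed.

Let WinvE (eps : crit_classes N beta -> R) v : class_simplex eps ->
  (Winv eps v)%:E = class_mixture eps v.
Proof.
move=> es; rewrite fineK// ge0_fin_numE ?mixture_ge0//.
by rewrite (le_lt_trans (mixture_le1 v es))// ltry.
Qed.

Let mixture_sum (eps : crit_classes N beta -> R) : class_simplex eps ->
  \esum_(v in [set: vert E]) class_mixture eps v = 1.
Proof.
move=> es; have [_ e1] := es; rewrite (eq_esum (fun v _ => mixtureE eps v)).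
rewrite esum_exchange => [|v c]; last by rewrite mule_ge0 ?hit_ge0// lee_fin ez_ge0.
rewrite -e1; apply: eq_esum => c _.
rewrite esumZl ?ez_ge0//; last exact: hit_ge0.
by rewrite -/(tot K _) -zE -EFinM mulfVK// gt_eqF.
Qed.

Let mixture_harm (eps : crit_classes N beta -> R) v : class_simplex eps ->
  \esum_(e in out_edges v) (N e `^ (- beta) * Winv eps (tgt e))%:E = class_mixture eps v.
Proof.
move=> es.
transitivity (step K (fun w => \esum_(c in [set: crit_classes N beta])
    ((eps c / z c)%:E * hit K (rep c) w)) v).
  by apply: eq_esum => e _; rewrite EFinM WinvE// mixtureE.
rewrite mixtureE /step.
have t0 c w : 0 <= (eps c / z c)%:E * hit K (rep c) w.
  by rewrite mule_ge0 ?hit_ge0// lee_fin ez_ge0.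
rewrite (eq_esum (b := fun e => \esum_(c in [set: crit_classes N beta])
    ((K e)%:E * ((eps c / z c)%:E * hit K (rep c) (tgt e))))); last first.
  by move=> e _; rewrite esumZl// ltW.
rewrite esum_exchange => [|e c]; last by rewrite mule_ge0// lee_fin ltW.
apply: eq_esum => c _.
have -> : hit K (rep c) v = step K (hit K (rep c)) v.
  by rewrite harmonic_hit//; have [] := crit_rep c.
by rewrite -stepZ ?ez_ge0//; exact: hit_ge0.
Qed.

Let Winv_Dbeta (eps : crit_classes N beta -> R) : class_simplex eps ->
  Dbeta Rg N beta (Winv eps).
Proof.
move=> es; split => [v||v _|v].
- by rewrite -!lee_fin WinvE// mixture_ge0// mixture_le1.
- by rewrite -(mixture_sum es); apply: eq_esum => v _; rewrite WinvE.
- by rewrite mixture_harm// WinvE.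
- by rewrite mixture_harm// WinvE.
Qed.

Let Winf_Winv (eps : crit_classes N beta -> R) : class_simplex eps ->
  Winf (Winv eps) = eps.
Proof.
move=> es; apply/funext => c; apply: EFin_inj.
rewrite WinfE EFinM WinvE// mixtureE (esumID [set c])//; last first.
  by move=> d _; rewrite mule_ge0 ?hit_ge0// lee_fin ez_ge0.
rewrite setTI esum_set1; last by rewrite mule_ge0 ?hit_ge0// lee_fin ez_ge0.
rewrite hit_self// mule1 esum1 ?adde0 => [|d [_ dc]].
  by rewrite -EFinM mulfVK// gt_eqF.
by rewrite (hit_rep_neq K_gt0 crit_rep rep_inj dc) mule0.
Qed.

(** The mixture is harmonic at every vertex, so an associated measure on infinite paths exists. By
    [walk_sum_crit] its critical walk sum is again the mixture, of total mass 1, as [recurrent_full]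
    requires. *)
Let Winv_con (eps : crit_classes N beta -> R) : class_simplex eps ->
  Dbeta_con Rg N beta (Winv eps).
Proof.
move=> es; have mD := Winv_Dbeta es; have [m01 m1 _ _] := mD.
split => //.
have [|v|x0 [mu [am mui]]] := @exists_associated_measure R E Rg N beta (Winv eps) N_gt0 _ m1.
- by move=> v; have /andP[] := m01 v.
- by rewrite mixture_harm// WinvE.
exists x0, mu; split => //.
apply: (recurrent_full N_gt0 mD am mui).
rewrite -(mixture_sum es); apply: le_esum => v _.
rewrite (walk_sum_crit K_gt0 crit_rep rep_onto rep_inj)//; last 2 first.
- exact: (Dbeta_superharmonic mD).
- by move=> x; rewrite ltry.
rewrite mixtureE; apply: le_esum => c _.
rewrite -[in leLHS](Winf_Winv es) WinfE mulfK// gt_eqF//.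
Qed.

(** The critical walk sum [g] is below [m] pointwise, and both have total mass 1, so they coincide;
    expanding [g] over the classes exhibits [m] as a mixture. *)
Let Winf_simplex m : Dbeta_con Rg N beta m ->
  class_simplex (Winf m : crit_classes N beta -> R) /\
  forall v, (m v)%:E = class_mixture (Winf m : crit_classes N beta -> R) v.
Proof.
move=> [mD [x0 [mu [am mur]]]]; have [m01 m1 _ _] := mD.
have fs := Dbeta_superharmonic mD.
have foo (x : vert E) : (m x)%:E < +oo by rewrite ltry.
have le1 := recurrent_mass N_gt0 mD am mur.
pose g := walk_sum K setT (~` crit K) (crit K) (fun v => (m v)%:E).
have gle v : g v <= (m v)%:E by exact: walk_sum_crit_le.
have g0 v : 0 <= g v by apply: walk_sum_ge0 => // x; exact: fs.1.
have gsum1 : \esum_(v in [set: vert E]) g v = 1.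
  by apply/eqP; rewrite eq_le le1 andbT -m1; apply: le_esum => v _; exact: gle.
have gm v : g v = (m v)%:E.
  apply: (@esum_eq_le _ _ setT g (fun v => (m v)%:E)) => //.
    by rewrite gsum1 ltry.
  by rewrite gsum1 m1.
have gE v : g v = \esum_(c in [set: crit_classes N beta])
    ((m (rep c))%:E * hit K (rep c) v).
  exact: (walk_sum_crit K_gt0 crit_rep rep_onto rep_inj).
split; last first.
  move=> v; rewrite -gm gE mixtureE; apply: eq_esum => c _.
  by rewrite WinfE mulfK// gt_eqF.
split; first by move=> c; exact: Winf01 mD.
rewrite -gsum1 (eq_esum (fun v _ => gE v)).
have m0 x : (0 <= m x)%R by have /andP[] := m01 x.
rewrite esum_exchange => [|v c]; last by rewrite mule_ge0 ?hit_ge0// lee_fin.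
apply: eq_esum => c _; rewrite esumZl//; last exact: hit_ge0.
by rewrite -/(tot K _) -zE WinfE EFinM.
Qed.

Let Winv_Winf m : Dbeta_con Rg N beta m -> Winv (Winf m) = m.
Proof.
by move=> /Winf_simplex [_ mE]; apply/funext => v; rewrite /Winv -mE.
Qed.

Local Close Scope ereal_scope.

Let Winf_affine (t : R) (x y : vert E -> R) :
  Winf (t *: x + (1 - t) *: y) =
  t *: (Winf x : crit_classes N beta -> R) + (1 - t) *: Winf y.
Proof.
apply/funext => c.
by rewrite /Winf /GRing.scale /= /GRing.add /= mulrDl -!mulrA.
Qed.

Let simplex_conv (t : R) (x y : crit_classes N beta -> R) : 0 <= t <= 1 ->
  class_simplex x -> class_simplex y -> class_simplex (t *: x + (1 - t) *: y).
Proof.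
move=> /andP[t0 t1] [x01 x1] [y01 y1].
have t1' : 0 <= 1 - t by rewrite subr_ge0.
have convE c : (t *: x + (1 - t) *: y) c = t * x c + (1 - t) * y c by [].
have sum : (\esum_(c in [set: crit_classes N beta])
    ((t *: x + (1 - t) *: y) c)%:E = 1)%E.
  rewrite (eq_esum (b := fun c => (t%:E * (x c)%:E + (1 - t)%:E * (y c)%:E)%E)); last first.
    by move=> c _; rewrite convE EFinD !EFinM.
  have x0 c : 0 <= x c by have /andP[] := x01 c.
  have y0 c : 0 <= y c by have /andP[] := y01 c.
  rewrite esumD; last 2 first.
  - by move=> c _; rewrite mule_ge0 ?lee_fin.
  - by move=> c _; rewrite mule_ge0 ?lee_fin.
  rewrite !esumZl ?x1 ?y1 ?mule1//; last first.
  - by rewrite -EFinD addrC subrK.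
split => // c; have /andP[cx0 cx1] := x01 c; have /andP[cy0 cy1] := y01 c.
by rewrite convE; apply/andP; split; nra.
Qed.

Let Winv_affine (t : R) (x y : crit_classes N beta -> R) : 0 <= t <= 1 ->
  class_simplex x -> class_simplex y ->
  Winv (t *: x + (1 - t) *: y) = t *: Winv x + (1 - t) *: Winv y.
Proof.
move=> t01 xs ys; have /andP[t0 t1] := t01.
have t1' : 0 <= 1 - t by rewrite subr_ge0.
apply/funext => v; apply: EFin_inj; rewrite WinvE; last exact: simplex_conv.
rewrite [RHS](_ : _ = (t%:E * (Winv x v)%:E + (1 - t)%:E * (Winv y v)%:E)%E); last by [].
rewrite !WinvE// !mixtureE -!esumZl//; last 2 first.
- by move=> c; rewrite mule_ge0 ?hit_ge0// lee_fin ez_ge0.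
- by move=> c; rewrite mule_ge0 ?hit_ge0// lee_fin ez_ge0.
rewrite -esumD; last 2 first.
- by move=> c _; rewrite !mule_ge0 ?hit_ge0 ?lee_fin ?ez_ge0.
- by move=> c _; rewrite !mule_ge0 ?hit_ge0 ?lee_fin ?ez_ge0.
apply: eq_esum => c _; rewrite -hE -!EFinM -EFinD; congr EFin.
have -> : (t *: x + (1 - t) *: y) c = t * x c + (1 - t) * y c by [].
by ring.
Qed.

Lemma Winf_convex_isomorphism :
  convex_isomorphism (Dbeta_con Rg N beta) (@class_simplex R E N beta)
    (@Winf R E N beta).
Proof.
split.
(* No measures are combined here: a convex combination of conservative functions is the image under
   the affine map [Winv] of a combination in the simplex. *)
- move=> x y t; rewrite !inE => xD yD.
  have t01 : 0 <= t%:num <= 1 by rewrite ge0 le1.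
  have [xs _] := Winf_simplex xD; have [ys _] := Winf_simplex yD.
  have := Winv_con (simplex_conv t01 xs ys).
  by rewrite Winv_affine// !Winv_Winf.
- move=> x y t; rewrite !inE; apply: simplex_conv.
  by rewrite ge0 le1.
- split.
  + by move=> m /Winf_simplex [].
  + by move=> x y; rewrite !inE => xD yD xy; rewrite -(Winv_Winf xD) xy Winv_Winf.
  + by move=> eps es; exists (Winv eps); [exact: Winv_con|exact: Winf_Winv].
- by move=> t x y _ _ _; exact: Winf_affine.
Qed.

Lemma Winf_inverse : exists2 Wi : (crit_classes N beta -> R) -> (vert E -> R),
  (forall eps, class_simplex eps -> forall v, (Wi eps v)%:E = class_mixture eps v) &
  (forall eps, class_simplex eps ->
     Dbeta_con Rg N beta (Wi eps) /\ Winf (Wi eps) = eps) /\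
  (forall m, Dbeta_con Rg N beta m -> Wi (Winf m) = m).
Proof.
exists Winv; first by move=> eps es v; exact: WinvE.
split; last exact: Winv_Winf.
by move=> eps es; split; [exact: Winv_con|exact: Winf_Winv].
Qed.

End Classification.

Theorem theorem5p13 (R : realType) (E : digraph) (Rg : set (vert E))
    (N : edge E -> R) (beta : R)
    (hRg : Rg `<=` @regular_vertices E)
    (hN : forall e, 1 < N e)
    (hbeta : 0 <= beta) :
  [/\ (forall m : vert E -> R, Dbeta Rg N beta m ->
        forall c : crit_classes N beta,
          (forall v, set_val c v ->
             (Winf m c)%:E = ((m v)%:E * Za N beta v)%E) /\
          0 <= Winf m c <= 1),
      convex_isomorphism (Dbeta_con Rg N beta) (@class_simplex R E N beta)
        (@Winf R E N beta),
      (forall (c : crit_classes N beta) v, set_val c v ->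
         mclass c = mvert N beta v) &
      exists2 Winv : (crit_classes N beta -> R) -> (vert E -> R),
        (forall eps, class_simplex eps ->
           forall v, (Winv eps v)%:E = class_mixture eps v) &
        (forall eps, class_simplex eps ->
           Dbeta_con Rg N beta (Winv eps) /\ Winf (Winv eps) = eps) /\
        (forall m, Dbeta_con Rg N beta m -> Winv (Winf m) = m)].
Proof.
have N_gt0 e : 0 < N e by exact: lt_trans (hN e).
split.
- move=> m mD c; split; last exact: Winf01 mD.
  by move=> v cv; exact: Winf_class mD cv.
- exact: Winf_convex_isomorphism.
- by move=> c v; exact: mclass_class.
- exact: Winf_inverse.
Qed.
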